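(* Let $M$ be a Frobenius meander. Then the spectrum of $M$ is symmetric and unbroken. That is, the distinct eigenvalues of $M$ form an unbroken sequence of consecutive integers $-a, -a+1, \ldots, 0, 1, \ldots, a, a+1$ for some integer $a$, and for every $e$ with $-a \le e \le a+1$ the dimension of $e$ equals the dimension of $1-e$.
   Context: Meanders. Let $n$ be a positive integer and let $(a_1,\ldots,a_k)$ and $(b_1,\ldots,b_m)$ be two ordered sequences of positive integers, each with sum $n$. The meander of type $\frac{a_1|a_2|\cdots|a_k}{b_1|b_2|\cdots|b_m}$ is the (multi)graph on vertices $v_1,\ldots,v_n$ placed left to right on a line, constructed as follows. Split $v_1,\ldots,v_n$ into consecutive top blocks of sizes $a_1,\ldots,a_k$, and also into consecutive bottom blocks of sizes $b_1,\ldots,b_m$. For each top block, with vertices $v_p,\ldots,v_q$, add the top edges $v_{p+i}v_{q-i}$ for all $i\ge 0$ with $p+i<q-i$. For each bottom block add bottom edges in the same way. A pair of vertices joined by both a top edge and a bottom edge forms a cycle. Every connected component is a path (possibly a single vertex) or a cycle. The index of the meander is $2C+P-1$, where $C$ is the number of cycles and $P$ the number of paths. The meander is Frobenius if its index is $0$, equivalently if the graph is a single path. Spectrum of a Frobenius meander. Orient every top edge from right to left and every bottom edge from left to right. For vertices $u,v$, the measure of $(u,v)$ is the number of forward edges minus the number of backward edges encountered when moving from $u$ to $v$ along the unique path of $M$ from $u$ to $v$ (so the measure of $(u,u)$ is $0$). An ordered pair $(v_i,v_j)$ is admissible if either $i<j$ and $v_i,v_j$ lie in the same bottom block, or $i\ge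 j$ and $v_i,v_j$ lie in the same top block. The spectrum of $M$ is the multiset of measures of all admissible pairs, with the multiplicity of $0$ reduced by one. Its elements are the eigenvalues of $M$, and the multiplicity of an eigenvalue in this multiset is its dimension. (By the eigenvalue algorithm of Gerstenhaber and Giaquinto, this is the spectrum, with multiplicities, of $\operatorname{ad}\hat F$, where $\hat F$ is a principal element of the Frobenius seaweed subalgebra of $\mathfrak{sl}(n)$ associated with $M$.) The spectrum of the one-vertex meander is empty and is regarded as trivially symmetric and unbroken. *)

(* Defs.v *)
From HB Require Import structures.
From mathcomp Require Import all_boot all_order all_algebra.

Set Implicit Arguments.
Unset Strict Implicit.
Unset Printing Implicit Defensive.

Import Order.TTheory GRing.Theory Num.Theory.

(* The vertices v_1, ..., v_n are the elements 0, ..., n-1 of 'I_n, and blocks *)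
(* are numbered from 0.                                                       *)

Definition composition (n : nat) (s : seq nat) : Prop :=
  all (fun x => 0 < x) s /\ sumn s = n.

(* Block r of s consists of the u with block_start s r <= u < block_start s   *)
(* r.+1.                                                                      *)
Definition block_start (s : seq nat) (r : nat) : nat := sumn (take r s).

Definition in_block (s : seq nat) (r u : nat) : bool :=
  block_start s r <= u < block_start s r.+1.

Definition same_block (s : seq nat) (u v : nat) : bool :=
  [exists r : 'I_(size s), in_block s r u && in_block s r v].

(* Here u is always the left endpoint: block_edge s u v implies u < v.        *)
Definition block_edge (s : seq nat) (u v : nat) : bool :=
  [exists r : 'I_(size s), exists t : 'I_(nth 0 s r),
     let p := block_start s r in
     let q := (block_start s r.+1).-1 in
     [&& p + t < q - t, u == p + t & v == q - t]].

(* Number of oriented edges from u to v; a is the top composition, whose      *)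
(* edges go from right to left, and b is the bottom one.                      *)
Definition arcs (a b : seq nat) (u v : nat) : nat :=
  block_edge a v u + block_edge b u v.

Definition edge_mult (a b : seq nat) (u v : nat) : nat :=
  arcs a b u v + arcs a b v u.

Definition adjacent (n : nat) (a b : seq nat) : rel 'I_n :=
  fun u v => 0 < edge_mult a b u v.

Definition components (n : nat) (a b : seq nat) : {set {set 'I_n}} :=
  equivalence_partition (connect (adjacent a b)) [set: 'I_n].

(* The submultigraph induced on K is a path (possibly a single vertex).       *)
Definition path_on (n : nat) (a b : seq nat) (K : {set 'I_n}) : bool :=
  [exists s : #|K|.-tuple 'I_n,
     [&& uniq s, [set x in s] == K &
      [forall i, forall j, edge_mult a b (tnth s i) (tnth s j)
         == (i.+1 == j) + (j.+1 == i)]]].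

(* The submultigraph induced on K is a cycle. If #|K| = 2 the condition asks  *)
(* for a double edge; if #|K| = 1 it asks for a double loop, which a meander  *)
(* does not have.                                                             *)
Definition cycle_on (n : nat) (a b : seq nat) (K : {set 'I_n}) : bool :=
  [exists s : #|K|.-tuple 'I_n,
     [&& uniq s, [set x in s] == K &
      [forall i, forall j, edge_mult a b (tnth s i) (tnth s j)
         == (i.+1 %% #|K| == j) + (j.+1 %% #|K| == i)]]].

Definition num_cycles (n : nat) (a b : seq nat) : nat :=
  #|[set K in components n a b | cycle_on a b K]|.

Definition num_paths (n : nat) (a b : seq nat) : nat :=
  #|[set K in components n a b | path_on a b K]|.

Local Open Scope ring_scope.

Definition meander_index (n : nat) (a b : seq nat) : int :=
  (2 * num_cycles n a b + num_paths n a b)%N%:Z - 1.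

Definition frobenius (n : nat) (a b : seq nat) : Prop := meander_index n a b = 0.

(* Forward minus backward edges along the walk u :: p. An edge that is not    *)
(* doubled contributes 1 or -1.                                               *)
Fixpoint walk_measure (n : nat) (a b : seq nat) (u : 'I_n) (p : seq 'I_n)
    : int :=
  if p is v :: p' then
    (arcs a b u v)%:Z - (arcs a b v u)%:Z + walk_measure a b v p'
  else 0.

Definition simple_path (n : nat) (a b : seq nat) (u v : 'I_n) (p : seq 'I_n)
    : bool :=
  [&& path (adjacent a b) u p, last u p == v & uniq (u :: p)].

(* The bound n on the length of p holds for every simple path. In a Frobenius *)
(* meander there is exactly one simple path from u to v, so that neither the  *)
(* choice made by pick nor the default value matters.                         *)
Definition measure (n : nat) (a b : seq nat) (u v : 'I_n) : int :=
  if [pick p : n.-bseq 'I_n | simple_path a b u v p] is Some p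
  then walk_measure a b u p else 0.

Definition admissible (n : nat) (a b : seq nat) (x : 'I_n * 'I_n) : bool :=
  ((x.1 < x.2)%N && same_block b x.1 x.2)
  || ((x.2 <= x.1)%N && same_block a x.1 x.2).

(* A multiset of integers, listed in an irrelevant order; rem removes one     *)
(* occurrence of 0.                                                           *)
Definition spectrum (n : nat) (a b : seq nat) : seq int :=
  rem 0 [seq measure a b x.1 x.2 | x : 'I_n * 'I_n in admissible a b].

Definition is_eigenvalue (n : nat) (a b : seq nat) (e : int) : bool :=
  e \in spectrum n a b.

Definition dimension (n : nat) (a b : seq nat) (e : int) : nat :=
  count_mem e (spectrum n a b).

(* Main.v *)
Require Import Defs.
From HB Require Import structures.
From mathcomp Require Import all_boot all_order all_algebra.
From mathcomp Require Import zify.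
Import Order.TTheory GRing.Theory Num.Theory.

(* The meander is a path, so the measure of (u, v) is h v - h u for a height  *)
(* h on the vertices, and in a top (bottom) block mirror images differ in     *)
(* height by 1 (-1).                                                          *)
(*   Symmetry. Mirroring one member of a pair of vertices of a block matches  *)
(* eigenvalue e with 1 - e, up to pairs {x, mirror of x} and centers; these   *)
(* are counted using that the path has n - 1 edges and exactly two ends.      *)
(*   Unbrokenness. View the meander as a plane arc and follow the gap between *)
(* two neighbouring vertices through the nested arcs. The height difference   *)
(* across such a strip, seen in the direction of travel, is constant except   *)
(* that it grows by 1 whenever the strip turns around an end of the arc. A    *)
(* strip that starts at an innermost arc starts with difference 1, so it      *)
(* cannot end at another innermost arc and leaves at a block boundary. There  *)
(* are as many innermost arcs between two vertices as block boundaries, so    *)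
(* every gap lies on such a strip and neighbours differ by 1, 2 or 3.         *)
(* Difference 3 occurs only after the strip has turned around both ends; it   *)
(* then runs next to an earlier portion of itself, whose heights fill the     *)
(* jump. Hence the heights in a half block leave no two consecutive integers  *)
(* out, unless the center has the lower of the two as its height, and this    *)
(* makes the eigenvalues of the block consecutive.                            *)

Set Implicit Arguments.
Unset Strict Implicit.
Unset Printing Implicit Defensive.
Local Open Scope nat_scope.

(** * Compositions and reflections of blocks *)

(** Everything is reduced to two [rainbow]s, top and bottom, that share one path:
    [frobenius_alternating] turns index 0 into an enumeration of the path with alternating colours,
    and [frobenius_height] gives the height. Symmetry: by [card_block_pairs], the pairs of one
    colour are symmetric under [e] and [1 - e] except that 0 has a surplus over 1, equal to the
    number of left halves plus centers. Over both colours the surplus is [n + 1]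
    ([card_left_halves]). It disappears because the [n] diagonal pairs are counted for both colours
    and one 0 is removed. Unbrokenness: [strip_cover] places every gap on a strip. Three facts are
    read off: [gap_rise], [steep_gap] and [center_steep]. From these alone [half_no_jump] and
    [attained_pred] show that an eigenvalue [e >= 2] of one colour brings [e - 1] with it. Symmetry
    then handles [e <= 0]. *)

Record rainbow (n : nat) (M : 'I_n -> 'I_n) (B : 'I_n -> nat) : Prop := Rainbow {
  rainbow_block : forall x, B (M x) = B x;
  rainbow_sum : forall x y, B x = B y -> M x + x = M y + y;
  rainbow_mono : forall x y : 'I_n, x <= y -> B x <= B y }.

Lemma block_startS s r : block_start s r.+1 = block_start s r + nth 0 s r.
Proof.
rewrite /block_start; elim: s r => [|k s IH] [|r] //=; first by rewrite take0 /= addn0.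
by rewrite IH addnA.
Qed.

Lemma leq_block_start s r t : r <= t -> block_start s r <= block_start s t.
Proof.
elim: t => [|t IH]; first by rewrite leqn0 => /eqP ->.
rewrite leq_eqVlt => /orP[/eqP -> //|/IH].
by rewrite block_startS => /leq_trans; apply; apply: leq_addr.
Qed.

Lemma in_block_inj s r t u : in_block s r u -> in_block s t u -> r = t.
Proof.
rewrite /in_block => /andP[r1 r2] /andP[t1 t2].
case: (ltngtP r t) => // lt.
- by have := leq_block_start s lt; lia.
- by have := leq_block_start s lt; lia.
Qed.

(** For [u] beyond the last block the value is [size s], which numbers no block; hence the bound in
    [block_ofP]. *)
Definition block_of (s : seq nat) (u : nat) : nat :=
  find (fun r => u < block_start s r.+1) (iota 0 (size s)).

Lemma block_ofP s u : u < sumn s -> block_of s u < size s /\ in_block s (block_of s u) u.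
Proof.
move=> us; rewrite /block_of; set p := (fun r => _).
have hp : has p (iota 0 (size s)).
  apply/hasP; exists (size s).-1; last first.
    rewrite /p /block_start take_oversize //; lia.
  rewrite mem_iota; case: s us {p} => //= *; lia.
have := hp; rewrite has_find size_iota => lt; split=> //.
have := nth_find 0 hp; rewrite nth_iota // add0n /p => H.
rewrite /in_block H andbT; case E : (find p _) => [|r]; first by rewrite /block_start take0.
have := @before_find _ 0 p (iota 0 (size s)) r; rewrite E ltnSn nth_iota; last by lia.
by rewrite add0n /p => /(_ isT); lia.
Qed.

Lemma same_blockE s u v : u < sumn s -> v < sumn s ->
  same_block s u v = (block_of s u == block_of s v).
Proof.
move=> /block_ofP[us ub] /block_ofP[vs vb].
apply/existsP/eqP => [[r /andP[ru rv]]|e].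
  by rewrite (in_block_inj ub ru) (in_block_inj vb rv).
by exists (Ordinal us); rewrite /= ub e vb.
Qed.

Section Reflection.

Variables (n : nat) (s : seq nat).
Hypothesis s_comp : composition n s.

Definition block_id (x : 'I_n) : nat := block_of s x.

(** The default [x] of [insubd] is never taken: for a composition of [n] the reflected number is a
    vertex, by [val_block_reflect]. *)
Definition block_reflect (x : 'I_n) : 'I_n :=
  insubd x (block_start s (block_of s x) + block_start s (block_of s x).+1 - 1 - x).

Let lt_sumn (x : 'I_n) : x < sumn s.
Proof. by rewrite s_comp.2. Qed.

Let block_start_le r : block_start s r <= n.
Proof.
have := leq_block_start s (leq_maxl r (size s)).
rewrite {2}/block_start take_oversize ?leq_maxr //; case: s_comp => _ ->; lia.
Qed.

Lemma val_block_reflect (x : 'I_n) :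
  block_reflect x = block_start s (block_of s x) + block_start s (block_of s x).+1 - 1 - x :> nat.
Proof.
rewrite /block_reflect val_insubd ifT //.
have [_ /andP[]] := block_ofP (lt_sumn x).
have := block_start_le (block_of s x).+1; lia.
Qed.

Lemma block_reflect_rainbow : rainbow block_reflect block_id.
Proof.
have H (x : 'I_n) : block_id (block_reflect x) = block_id x.
  have [_ xb] := block_ofP (lt_sumn x); have [_ yb] := block_ofP (lt_sumn (block_reflect x)).
  apply: (in_block_inj yb); rewrite /in_block val_block_reflect.
  by move: xb; rewrite /in_block /block_id; lia.
split=> // x y.
- rewrite /block_id => e; rewrite !val_block_reflect -e.
  have [_ ] := block_ofP (lt_sumn x); have [_ ] := block_ofP (lt_sumn y).
  by rewrite /in_block -e; lia.
- move=> xy; rewrite /block_id leqNgt; apply/negP => lt.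
  have [_ /andP[_ yb]] := block_ofP (lt_sumn y).
  have [_ /andP[xb _]] := block_ofP (lt_sumn x).
  by have := leq_block_start s lt; lia.
Qed.

Lemma same_block_id (x y : 'I_n) : same_block s x y = (block_id x == block_id y).
Proof. exact: same_blockE. Qed.

Lemma block_edge_reflect (x y : 'I_n) :
  block_edge s x y = (x < y) && (y == block_reflect x).
Proof.
apply/existsP/andP => [[r /existsP[t /and3P[lt /eqP ex /eqP ey]]]|[lt /eqP ey]].
  have xb : in_block s r x.
    by rewrite /in_block ex !block_startS; have := ltn_ord t; lia.
  have [_ xb'] := block_ofP (lt_sumn x).
  split; first by rewrite ex ey.
  apply/eqP/val_inj; rewrite /= val_block_reflect (in_block_inj xb' xb) ey ex.
  by have := ltn_ord t; rewrite block_startS; lia.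
have [rs xb] := block_ofP (lt_sumn x); exists (Ordinal rs) => /=.
have tP : x - block_start s (block_of s x) < nth 0 s (block_of s x).
  by move: xb; rewrite /in_block block_startS; lia.
apply/existsP; exists (Ordinal tP) => /=.
have := val_block_reflect x; rewrite -ey => ey'.
have ey2 : (y : nat) = block_start s (block_of s x) + block_start s (block_of s x).+1 - 1 - x.
  by rewrite ey'.
move: xb lt; rewrite /in_block ey2; move: (block_start _ _) (block_start _ _) => p q.
move: (nat_of_ord x) => z; lia.
Qed.

End Reflection.

(** * Components of a meander *)

(** [c] is the colour of the first edge. At an end of the path one colour has no further edge, so
    its involution fixes the end; this is how the ends appear as centers of odd blocks. *)
Record alternating_path (n : nat) (M : bool -> 'I_n -> 'I_n) (v : nat -> 'I_n) (c : bool)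
    : Prop := AlternatingPath {
  alt_inj : forall i j, i < n -> j < n -> v i = v j -> i = j;
  alt_surj : forall x, exists2 i, i < n & v i = x;
  alt_step : forall i, i.+1 < n -> M (c (+) odd i) (v i) = v i.+1;
  alt_first : M (~~ c) (v 0) = v 0;
  alt_last : M (c (+) odd n.-1) (v n.-1) = v n.-1 }.

Lemma rainbowK n (M : 'I_n -> 'I_n) B : rainbow M B -> involutive M.
Proof.
move=> rb x; apply/val_inj/eqP; rewrite -(eqn_add2r (M x)).
by rewrite (rainbow_sum rb (rainbow_block rb x)) addnC.
Qed.

Section Meander.

Variables (n : nat) (a b : seq nat).
Hypotheses (a_comp : composition n a) (b_comp : composition n b).

Definition mate (c : bool) : 'I_n -> 'I_n := block_reflect (if c then a else b).
Definition block (c : bool) : 'I_n -> nat := block_id (if c then a else b).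

Lemma mate_rainbow c : rainbow (mate c) (block c).
Proof. by case: c; apply: block_reflect_rainbow. Qed.

Lemma mateK c : involutive (mate c).
Proof. exact: rainbowK (mate_rainbow c). Qed.

Lemma mate_eq c u v : (u == mate c v) = (v == mate c u).
Proof. by apply/eqP/eqP => ->; rewrite mateK. Qed.

Lemma arcsE (u v : 'I_n) :
  arcs a b u v = ((v < u) && (v == mate true u)) + ((u < v) && (v == mate false u)).
Proof.
rewrite /arcs !block_edge_reflect //; congr (_ + _); congr nat_of_bool.
by congr andb; exact: mate_eq true u v.
Qed.

Lemma edge_multE (u v : 'I_n) :
  edge_mult a b u v = (u != v) && (v == mate true u) + ((u != v) && (v == mate false u)).
Proof.
rewrite /edge_mult !arcsE -[u == v](inj_eq val_inj) /=.
rewrite (mate_eq true u v) (mate_eq false u v).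
by case: (v == _); case: (v == _); case: ltngtP.
Qed.

Lemma edge_multC (u v : 'I_n) : edge_mult a b u v = edge_mult a b v u.
Proof. exact: addnC. Qed.

Lemma edge_multxx (u : 'I_n) : edge_mult a b u u = 0.
Proof. by rewrite edge_multE eqxx. Qed.

Lemma edge_mult_le2 (u v : 'I_n) : edge_mult a b u v <= 2.
Proof. by rewrite edge_multE; case: (_ && _); case: (_ && _). Qed.

(** A vertex has at most one top and one bottom edge, so two distinct neighbours use up both. *)
Lemma edge_mult_degree (u v w z : 'I_n) : v != w ->
  0 < edge_mult a b u v -> 0 < edge_mult a b u w ->
  edge_mult a b u z = (z == v) + (z == w).
Proof.
rewrite !edge_multE; move: (mate true u) (mate false u) => p q vw.
case: (eqVneq u v) => //= uv; case: (eqVneq u w) => //= uw; rewrite !addn_gt0 !lt0b.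
have zE t : u != t -> (u != z) && (z == t) = (z == t).
  by move=> ut; case: (z =P t) => [->|]; rewrite ?andbF // andbT ut.
case/orP => /eqP pv /orP[] /eqP pw; subst.
- by rewrite eqxx in vw.
- by rewrite !zE.
- by rewrite !zE // addnC.
- by rewrite eqxx in vw.
Qed.

Lemma adjacent_sym : symmetric (@adjacent n a b).
Proof. by move=> u v; rewrite /adjacent edge_multC. Qed.

Lemma components_partition : partition (components n a b) [set: 'I_n].
Proof.
apply: equivalence_partitionP => x y z _ _ _; split; first exact: connect0.
move=> xy; apply/idP/idP; last exact: connect_trans.
by apply: connect_trans; rewrite (sym_connect_sym adjacent_sym).
Qed.

Section Component.

Variables (x : 'I_n) (K : {set 'I_n}).
Hypothesis K_def : K = [set y | connect (adjacent a b) x y].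

Let trail (m : nat) : bool :=
  [exists s : m.-tuple 'I_n, [&& sorted (adjacent a b) s, uniq s & [set y in s] \subset K]].

(** Take a longest trail. A neighbour outside it would prolong it at an end, and would be a third
    neighbour of an interior vertex. *)
Lemma maximal_trail : exists2 s : seq 'I_n,
  [/\ 0 < size s, sorted (adjacent a b) s, uniq s & {subset s <= K}] &
  forall y i, i < size s -> adjacent a b (nth x s i) y -> y \in s.
Proof.
have ex1 : exists m, trail m.
  exists 1; apply/existsP; exists [tuple x] => /=.
  by apply/subsetP => y; rewrite !inE K_def inE => /eqP ->; apply: connect0.
have ub m : trail m -> m <= n.
  case/existsP => s /and3P[_ us _]; rewrite -[m](size_tuple s) -(card_uniqP us).
  by rewrite -[X in _ <= X](card_ord n); apply: max_card.
case: (ex_maxnP ex1 ub) => m /existsP[s /and3P[ss us /subsetP sK]] max_m.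
have sK' : {subset s <= K} by move=> y ys; apply: sK; rewrite inE.
have m_gt0 : 0 < m.
  apply: max_m; apply/existsP; exists [tuple x] => /=.
  by apply/subsetP => y; rewrite !inE K_def inE => /eqP ->; apply: connect0.
have maxi (t : seq 'I_n) : size t = m.+1 -> sorted (adjacent a b) t -> uniq t ->
    {subset t <= K} -> False.
  move=> st tt ut tK; have := max_m m.+1; rewrite ltnn => H; apply/notF/H.
  apply/existsP; exists (Tuple (introT eqP st)); rewrite /= tt ut.
  by apply/subsetP => y; rewrite inE; apply: tK.
have Kadj y z : y \in K -> adjacent a b y z -> z \in K.
  by rewrite K_def !inE => xy yz; apply: connect_trans xy (connect1 yz).
exists s; first by rewrite size_tuple.
move=> y i; rewrite size_tuple => im siy; apply/negPn/negP => ys.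
have siK : nth x s i \in K by apply: sK'; rewrite mem_nth ?size_tuple.
have yK := Kadj _ _ siK siy.
have adjS k : k.+1 < m -> adjacent a b (nth x s k) (nth x s k.+1).
  by move=> km; apply: (sortedP x ss); rewrite size_tuple.
case: i => [|i] in im siy siK *.
- apply: (maxi (y :: s)); rewrite /= ?size_tuple ?ys //; last first.
    by move=> z; rewrite inE => /orP[/eqP ->|/sK'].
  case: (tval s) (size_tuple s) siy ss => [|z t] /=; first by move=> e; rewrite -e in im.
  by move=> _ ; rewrite adjacent_sym => -> ->.
case: (ltnP i.+2 m) => im2.
- have A1 := adjS _ im2; have A0 := adjS _ im; rewrite adjacent_sym in A0.
  have ne : nth x s i != nth x s i.+2.
    by rewrite nth_uniq ?size_tuple //; lia.
  have := edge_mult_degree y ne A0 A1; move: siy; rewrite /adjacent => siy e.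
  move: siy; rewrite e.
  by case: eqP ys => [->|_]; [rewrite mem_nth ?size_tuple //; lia|
     case: eqP => [->|//]; rewrite mem_nth ?size_tuple].
- apply: (maxi (rcons s y)); rewrite ?size_rcons ?size_tuple ?rcons_uniq ?ys //; last first.
    by move=> z; rewrite mem_rcons inE => /orP[/eqP ->|/sK'].
  apply/(sortedP x) => k; rewrite size_rcons size_tuple ltnS => km.
  rewrite !nth_rcons size_tuple km.
  case: (ltngtP k.+1 m) => km'; [exact: adjS | lia |].
  by have -> : k = i.+1 by lia.
Qed.

(** A trail closed under adjacency exhausts the component. Its multiplicities are all forced except
    the one between its two ends, which decides between path and cycle. *)
Lemma path_or_cycle : path_on a b K || cycle_on a b K.
Proof.
have [s [s_gt0 ss us sK] clo] := maximal_trail.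
have closed_s y z : y \in s -> adjacent a b y z -> z \in s.
  by move=> /(nthP x)[i im <-]; apply: clo.
have s0 : nth x s 0 \in s by rewrite mem_nth.
have Ks y : y \in K -> y \in s.
  move=> yK; have : connect (adjacent a b) (nth x s 0) y.
    move: yK (sK _ s0); rewrite K_def !inE => xy xs; apply: connect_trans xy.
    by rewrite (sym_connect_sym adjacent_sym).
  case/connectP => p; move: s0; move: (nth x s 0) => z.
  elim: p z => [|w p IH] z zs /=; first by move=> _ ->.
  by case/andP => /(closed_s _ _ zs) ws pw; apply: IH.
have KE : [set y in s] = K.
  by apply/setP => y; rewrite inE; apply/idP/idP => [/sK|/Ks].
have szK : size s = #|K| by rewrite -KE cardsE (card_uniqP us).
set m := size s in szK; set f := nth x s.
have fI i j : i < m -> j < m -> (f i == f j) = (i == j) by move=> *; rewrite nth_uniq.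
have step i : i.+1 < m -> 0 < edge_mult a b (f i) (f i.+1).
  by move=> im; apply: (sortedP x ss).
have interior i j : i.+2 < m -> j < m ->
    edge_mult a b (f i.+1) (f j) = (i == j) + (i.+2 == j).
  move=> im jm; have A0 := step i (ltnW im); rewrite edge_multC in A0.
  have ne : f i != f i.+2 by rewrite fI; lia.
  rewrite (edge_mult_degree _ ne A0 (step _ im)) !fI; lia.
pose c := edge_mult a b (f 0) (f m.-1).
have c_le : 2 < m -> c <= 1.
  move=> m2; case: (posnP c) => [->//|c_gt0].
  have ne : f 1 != f m.-1 by rewrite fI; lia.
  by rewrite /c (edge_mult_degree _ ne (step 0 (ltnW m2)) c_gt0) !fI; lia.
have first i : 2 < m -> i < m -> edge_mult a b (f 0) (f i) = (i == 1) + c * (i == m.-1).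
  move=> m2 im; case: i im => [|[|i]] im.
  - by rewrite edge_multxx; lia.
  - by rewrite edge_multC interior //; lia.
  - case: (ltnP i.+3 m) => im3; first by rewrite edge_multC interior //; lia.
    have -> : i.+2 = m.-1 by lia.
    by rewrite -/c; lia.
have lastE i : 2 < m -> i < m -> edge_mult a b (f m.-1) (f i) = (i == m.-2) + c * (i == 0).
  move=> m2 im; case: i im => [|i] im; first by rewrite edge_multC -/c; lia.
  case: (ltnP i.+2 m) => im2; first by rewrite edge_multC interior //; lia.
  have -> : i.+1 = m.-1 by lia.
  by rewrite edge_multxx; lia.
have all_mult i j : 2 < m -> i < m -> j < m ->
    edge_mult a b (f i) (f j) =
    (i.+1 == j) + (j.+1 == i) + c * (((i == 0) && (j == m.-1)) + ((j == 0) && (i == m.-1))).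
  move=> m2 im jm; case: i im => [|i] im; first by rewrite first //; lia.
  case: (ltnP i.+2 m) => im2; first by rewrite interior //; lia.
  have -> : i.+1 = m.-1 by lia.
  rewrite lastE //; lia.
pose t := Tuple (introT eqP szK).
have tE i : tnth t i = f i by rewrite (tnth_nth x).
have ti (i : 'I_#|K|) : i < m by rewrite szK.
(* With one or two vertices the ends coincide or are consecutive in the trail. For two, a single
   edge makes a path and a double edge a cycle. *)
have [m1|[m2|m3]] : m = 1 \/ m = 2 \/ 2 < m by lia.
- apply/orP; left; apply/existsP; exists t; rewrite us KE eqxx /=.
  apply/forallP => i; apply/forallP => j; rewrite !tE; have := ti i; have := ti j.
  rewrite m1; case: (nat_of_ord i) (nat_of_ord j) => [|?] [|?] //= _ _.
  by rewrite edge_multxx.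
- have := edge_mult_le2 (f 0) (f 1); have := step 0; rewrite m2 => /(_ isT).
  case E : (edge_mult a b (f 0) (f 1)) => [|[|[|e]]] // _ _.
  + apply/orP; left; apply/existsP; exists t; rewrite us KE eqxx /=.
    apply/forallP => i; apply/forallP => j; rewrite !tE; have := ti i; have := ti j.
    rewrite m2; case: (nat_of_ord i) (nat_of_ord j) => [|[|?]] [|[|?]] //= _ _;
      by rewrite ?edge_multxx // ?E // edge_multC E.
  + apply/orP; right; apply/existsP; exists t; rewrite us KE eqxx /=.
    apply/forallP => i; apply/forallP => j; rewrite !tE; have := ti i; have := ti j.
    move: (nat_of_ord i) (nat_of_ord j) => p q; rewrite -szK m2; case: p q => [|[|?]] [|[|?]] //= _ _;
      by rewrite ?edge_multxx // ?E // edge_multC E.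
have modE i : i < m -> i.+1 %% m = if i == m.-1 then 0 else i.+1.
  move=> im; case: eqP => [->|ne]; first by rewrite prednK ?modnn //; lia.
  by rewrite modn_small //; lia.
have := c_le m3; case E : c all_mult => [|[|//]] all_mult _.
- apply/orP; left; apply/existsP; exists t; rewrite us KE eqxx /=.
  apply/forallP => i; apply/forallP => j; rewrite !tE all_mult //.
  by rewrite mul0n addn0.
- apply/orP; right; apply/existsP; exists t; rewrite us KE eqxx /=.
  apply/forallP => i; apply/forallP => j; rewrite !tE all_mult //; have := ti j; have := ti i.
  move: (nat_of_ord i) (nat_of_ord j) => p q pm qm; rewrite -szK !modE //.
  by rewrite mul1n; case: (p =P m.-1); case: (q =P m.-1); lia.
Qed.



End Component.
End Meander.

(** * Enumeration and heights of a Frobenius meander *)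

Section Frobenius.

Variables (n : nat) (a b : seq nat).
Hypotheses (n_gt0 : 0 < n) (a_comp : composition n a) (b_comp : composition n b).
Hypothesis M_frob : frobenius n a b.

(** [2C + P = 1] forces [C = 0] and [P = 1]; since every component is a path or a cycle, there is
    only one. *)
Lemma frobenius_components : components n a b = [set setT] /\ path_on a b [set: 'I_n].
Proof.
have [nc np] : num_cycles n a b = 0 /\ num_paths n a b = 1.
  move: M_frob; rewrite /frobenius /meander_index; lia.
have pathP K : K \in components n a b -> path_on a b K.
  move=> KP; have := KP; case/imsetP => x _ KE.
  have KE' : K = [set y | connect (adjacent a b) x y].
    by rewrite KE; apply/setP => y; rewrite !inE.
  have := path_or_cycle a_comp b_comp KE' => /orP[//|Kc].
  have /cards0_eq/setP/(_ K) := nc.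
  by rewrite !inE KP Kc.
have /eqP/cards1P[K KE] : #|components n a b| = 1.
  rewrite -np /num_paths; apply: eq_card => K; rewrite inE.
  by case KP : (K \in _) => //=; rewrite pathP.
have := cover_partition (components_partition n a b).
rewrite KE /cover big_set1 => KT; rewrite -KT; split=> //.
by apply: pathP; rewrite KE inE.
Qed.

Lemma frobenius_enumeration : exists v : nat -> 'I_n,
  [/\ forall i j, i < n -> j < n -> v i = v j -> i = j,
      forall x, exists2 i, i < n & v i = x &
      forall i j, i < n -> j < n -> edge_mult a b (v i) (v j) = (i.+1 == j) + (j.+1 == i)].
Proof.
have [_ /existsP[s /and3P[us /eqP sT /forallP sE]]] := frobenius_components.
have szs : size s = n by rewrite size_tuple cardsT card_ord.
pose x0 := Ordinal n_gt0; exists (nth x0 s); split.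
- by move=> i j im jm /eqP; rewrite nth_uniq ?szs // => /eqP.
- move=> x; have : x \in s by have /setP/(_ x) := sT; rewrite !inE.
  by move=> /(nthP x0)[i]; rewrite szs => im <-; exists i.
- move=> i j im jm; have cT : #|[set: 'I_n]| = n by rewrite cardsT card_ord.
  rewrite -cT in im jm; have /forallP/(_ (Ordinal jm))/eqP := sE (Ordinal im).
  by rewrite !(tnth_nth x0).
Qed.

(** Each edge of the path is simple, so it has exactly one colour, and two successive edges of equal
    colour would contradict that [mate] is an involution. *)
Lemma frobenius_alternating : exists (v : nat -> 'I_n) (c : bool), alternating_path (mate a b) v c /\
  forall i j, i < n -> j < n -> edge_mult a b (v i) (v j) = (i.+1 == j) + (j.+1 == i).
Proof.
have [v [vI vS vE]] := frobenius_enumeration.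
have edge c i j : i < n -> j < n -> mate a b c (v i) = v j -> i != j ->
    (i.+1 == j) || (j.+1 == i).
  move=> im jm e ij; have := vE i j im jm; rewrite edge_multE // -e.
  have -> : v i != mate a b c (v i).
    by rewrite e; apply: contra ij => /eqP/vI ->.
  by case: c {e} => /=; rewrite eqxx ?addn1; case: (i.+1 == j); case: (j.+1 == i).
pose col i := mate a b true (v i) == v i.+1.
have colP i : i.+1 < n -> mate a b (col i) (v i) = v i.+1 /\ mate a b (~~ col i) (v i) != v i.+1.
  move=> im; have := vE i i.+1 (ltnW im) im; rewrite eqxx edge_multE // /col.
  rewrite ![v i.+1 == _]eq_sym; case: (v i != v i.+1) => //=.
  have -> : (i.+2 == i) = false by lia.
  by case: eqP => /= [-> |ne]; case: eqP => //= ? _; split=> //; apply/eqP.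
have colS i : i.+2 < n -> col i.+1 = ~~ col i.
  move=> im; have [e1 _] := colP i (ltnW im); have [e2 _] := colP i.+1 im.
  case: (eqVneq (col i.+1) (col i)) => [E|]; last by case: (col i.+1); case: (col i).
  move: e2; rewrite E -e1 mateK // => /vI; lia.
pose c := col 0; exists v, c.
have colE i : i.+1 < n -> col i = c (+) odd i.
  elim: i => [|i IH] im; first by rewrite addbF.
  by rewrite colS // IH ?(ltnW im) //= addbN.
split=> //; split=> //.
- by move=> i im; rewrite -colE //; case: (colP i im).
(* If the other colour moved [v 0], it would lead to the only neighbour [v 1] and double the first
   edge. *)
- have [j jm e] := vS (mate a b (~~ c) (v 0)); rewrite -e; congr v.
  case: (eqVneq 0 j) => // j0; have := edge _ _ _ n_gt0 jm (esym e) j0.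
  rewrite orbF => /eqP j1; subst j.
  by have [_] := colP 0 jm; rewrite -e eqxx.
- have [j jm e] := vS (mate a b (c (+) odd n.-1) (v n.-1)); rewrite -e; congr v.
  have n1 : n.-1 < n by rewrite prednK.
  case: (eqVneq n.-1 j) => // j0; have := edge _ _ _ n1 jm (esym e) j0.
  case/orP => /eqP jE; first by move: jm; rewrite -jE prednK // ltnn.
  have jm' : j.+1 < n by rewrite jE.
  have [_] := colP j jm'; rewrite colE // jE -addbN.
  move: e; rewrite -jE /= => e.
  by rewrite e addbN mateK // eqxx.
Qed.

Local Open Scope ring_scope.

(** The height sums the signed arcs from [v 0] onwards. Along any walk the increments telescope, so
    the walk picked by [measure] is irrelevant. Top edges point left, whence the [-1]. *)
Lemma frobenius_height : exists h : 'I_n -> int,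
  (forall c (x : 'I_n), (x < mate a b c x)%N -> h (mate a b c x) = h x + (if c then -1 else 1)) /\
  (forall u w, measure a b u w = h w - h u).
Proof.
have [v [vI vS vE]] := frobenius_enumeration.
pose idx (x : 'I_n) := find (fun i => v i == x) (iota 0 n).
have idxK i : (i < n)%N -> idx (v i) = i.
  move=> im; have hp : has (fun j => v j == v i) (iota 0 n).
    by apply/hasP; exists i; rewrite ?mem_iota ?eqxx.
  have := nth_find 0%N hp; have := hp; rewrite has_find size_iota => lt.
  by rewrite nth_iota // add0n => /eqP/vI; apply.
pose delta (u w : 'I_n) : int := (arcs a b u w)%:Z - (arcs a b w u)%:Z.
pose h (x : 'I_n) : int := \sum_(0 <= t < idx x) delta (v t) (v t.+1).
have hE (u w : 'I_n) : (0 < edge_mult a b u w)%N -> h w - h u = delta u w.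
  have [i im <-] := vS u; have [j jm <-] := vS w.
  rewrite vE // /h !idxK // addn_gt0 !lt0b => /orP[] /eqP <-.
  - by rewrite big_nat_recr //= addrAC subrr add0r.
  - by rewrite big_nat_recr //= opprD addrA subrr add0r /delta opprB.
exists h; split=> [c x lt|u w].
  have x0 : x != mate a b c x by apply: contraTneq lt => <-; rewrite ltnn.
  have e1 : edge_mult a b x (mate a b c x) = 1%N.
    have [i im ei] := vS x; have [j jm ej] := vS (mate a b c x).
    have e : (0 < edge_mult a b x (mate a b c x))%N.
      by rewrite edge_multE // x0; case: (c); rewrite eqxx ?addn1.
    by move: e; rewrite -ej -ei vE //; lia.
  have := hE x (mate a b c x); rewrite e1 => /(_ isT) /(canRL (subrK _)) ->.
  rewrite addrC; congr (_ + _); rewrite /delta.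
  have := e1; rewrite edge_multE // x0 /= !arcsE // ltnNge (ltnW lt) lt /=.
  rewrite (mate_eq a_comp b_comp true x) addn0.
  by case: c {e1 x0 lt} => /=; rewrite eqxx; case: (_ == _).
have walk p (u' : 'I_n) : path (adjacent a b) u' p -> walk_measure a b u' p = h (last u' p) - h u'.
  elim: p u' => [|z p IH] u' /=; first by rewrite subrr.
  by case/andP => /hE e pz; rewrite IH // -/(delta u' z) -e addrC subrKA.
rewrite /measure; case: pickP => [p /and3P[pp /eqP pl _]|np].
  by rewrite walk // pl.
have : connect (adjacent a b) u w.
  have [KE _] := frobenius_components.
  have : [set y | connect (adjacent a b) u y] \in components n a b.
    apply/imsetP; exists u; rewrite ?inE //.
    by apply/setP => y; rewrite !inE.
  by rewrite KE inE => /eqP/setP/(_ w); rewrite !inE.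
case/connectP => p0 p0p ew; case/shortenP: p0p ew => p pp up _ ew.
have sp : (size p <= n)%N.
  have /card_uniqP e := up; have := max_card [in u :: p].
  by rewrite e card_ord => /ltnW.
by have /negP[] := negbT (np (Bseq sp)); apply/and3P; split=> //; rewrite ew.
Qed.

End Frobenius.

(** * Symmetry of the block pairs *)

Section Pairs.

Variables (n : nat) (M : 'I_n -> 'I_n) (B : 'I_n -> nat) (k : 'I_n -> int).
Hypothesis MB : rainbow M B.
Hypothesis kM : forall x : 'I_n, x < M x -> k (M x) = (k x - 1)%R.

(** With [k = h] on top and [k = -h] at the bottom both colours satisfy [kM]; the left vertex is the
    second member. *)
Definition block_pairs (e : int) : {set 'I_n * 'I_n} :=
  [set p | [&& B p.1 == B p.2, (p.2 <= p.1)%N & (k p.2 - k p.1 == e)%R]].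

(** The midpoint of the pair lies at or left of the middle of the block for [low], at or right of it
    for [high]. Common to both are the pairs of a left vertex and its mirror; missed by both are the
    centers paired with themselves. *)
Let low (e : int) : {set 'I_n * 'I_n} :=
  [set p in block_pairs e | (p.2 < M p.2) && (p.1 <= M p.2)].
Let high (e : int) : {set 'I_n * 'I_n} :=
  [set p in block_pairs e | (M p.1 < p.1) && (M p.1 <= p.2)].

Let MK := rainbowK MB.
Let sumE x y : B x == B y -> M x + x = M y + y.
Proof. by move/eqP; apply: (rainbow_sum MB). Qed.

(* Shifting a pair (x, y) to (M y, x) turns an eigenvalue e into 1 - e. *)
Let card_low e : #|low e| = #|high (1 - e)%R|.
Proof.
have inj : injective (fun p : 'I_n * 'I_n => (M p.2, p.1)).
  by move=> [x y] [x' y'] [/(inv_inj MK) -> ->].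
rewrite -(card_imset _ inj); apply: eq_card => -[X Y].
apply/imsetP/idP => [[[x y]]|].
- rewrite !inE /= => /andP[/and3P[bxy yx /eqP <-] /andP[yM xM]] [-> ->].
  rewrite MK (rainbow_block MB) eq_sym bxy xM yM yx (kM yM) /=.
  by rewrite andbT; apply/eqP; lia.
- rewrite !inE /= => /andP[/and3P[bxy yx /eqP e1] /andP[yM xM]].
  exists (Y, M X); rewrite /= ?MK // !inE /= MK (rainbow_block MB) eq_sym bxy xM yM yx /=.
  have := kM (x := M X); rewrite MK => /(_ yM) kE.
  by rewrite andbT; apply/eqP; lia.
Qed.

Definition left_half : {set 'I_n} := [set x : 'I_n | x < M x].
Definition centers : {set 'I_n} := [set x : 'I_n | M x == x].

Lemma card_halves : 2 * #|left_half| + #|centers| = n.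
Proof.
have := cardsC left_half; rewrite card_ord.
have e : #|[set x : 'I_n | M x < x]| = #|left_half|.
  rewrite -(card_imset _ (inv_inj MK)); apply: eq_card => x.
  apply/imsetP/idP => [[y]|]; first by rewrite !inE => lt ->; rewrite MK.
  by rewrite inE => lt; exists (M x); rewrite ?inE MK.
have -> : ~: left_half = [set x : 'I_n | M x < x] :|: centers.
  by apply/setP => x; rewrite !inE -(inj_eq val_inj) /=; case: ltngtP.
rewrite cardsU e disjoint_setI0 ?cards0 ?subn0; first lia.
rewrite -setI_eq0; apply/eqP/setP => x; rewrite !inE -(inj_eq val_inj) /=.
by case: ltngtP.
Qed.

(** Inclusion and exclusion on [low] and [high], which trade places under [e] and [1 - e]. The
    overlap has eigenvalue 1, the missed pairs have eigenvalue 0. *)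
Lemma card_block_pairs e :
  #|block_pairs e| + (#|left_half| + #|centers|) * (e == 1)%R =
  #|block_pairs (1 - e)%R| + (#|left_half| + #|centers|) * (e == 0)%R.
Proof.
suff count f : #|block_pairs f| + #|left_half| * (f == 1)%R =
    #|low f| + #|high f| + #|centers| * (f == 0)%R.
  have := count e; have := count (1 - e)%R; rewrite !card_low.
  have -> : (1 - (1 - e))%R = e by lia.
  have -> : (1 - e == 1)%R = (e == 0)%R by lia.
  have -> : (1 - e == 0)%R = (e == 1)%R by lia.
  lia.
pose mid : {set 'I_n * 'I_n} := [set p in block_pairs f | (M p.1 == p.1) && (p.1 == p.2)].
have -> : block_pairs f = (low f :|: high f) :|: mid.
  apply/setP => -[x y]; rewrite /low /high /mid !inE /= -!andb_orr.
  case: (boolP (_ && _)) => //= /and3P[bxy yx _]; have := sumE bxy.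
  by rewrite -!(inj_eq val_inj) /=; lia.
have midE : #|mid| = #|centers| * (f == 0)%R.
  have inj : injective (fun x : 'I_n => (x, x)) by move=> x y [].
  case: (eqVneq f 0%R) => [f0|f0]; last first.
    rewrite muln0; apply/eqP; rewrite cards_eq0; apply/eqP/setP => -[x y].
    rewrite !inE /=; case: (eqVneq x y) => [<-|]; rewrite ?andbF //.
    by rewrite subrr eq_sym (negPf f0) !andbF.
  rewrite muln1 -(card_imset _ inj); apply: eq_card => -[x y].
  apply/idP/imsetP => [|[z]]; last by rewrite !inE => /eqP Mz [-> ->] /=; rewrite Mz !eqxx f0 subrr leqnn eqxx.
  by rewrite !inE /= => /andP[_ /andP[Mx /eqP <-]]; exists x; rewrite ?inE.
have interE : #|low f :&: high f| = #|left_half| * (f == 1)%R.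
  have inj : injective (fun x : 'I_n => (M x, x)) by move=> x y [].
  have lhE x y : (x, y) \in low f :&: high f = (x == M y) && (y < M y) && (f == 1)%R.
    rewrite !inE /=; apply/idP/idP => [|/andP[/andP[/eqP -> lt] /eqP ->]].
      move=> /andP[/andP[/and3P[bxy yx /eqP <-] /andP[yM xM]] /andP[_ /andP[_ Mxy]]].
      have xE : x = M y by apply/val_inj => /=; have := sumE bxy; lia.
      rewrite xE eqxx yM (kM yM) /=; apply/eqP; lia.
    rewrite MK (rainbow_block MB) eqxx lt ltnW // !leqnn (kM lt) /=.
    by have -> : (k y - (k y - 1) == 1)%R by lia.
  case: (eqVneq f 1%R) => [f1|f1]; last first.
    rewrite muln0; apply/eqP; rewrite cards_eq0; apply/eqP/setP => -[x y].
    by rewrite lhE (negPf f1) andbF inE.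
  rewrite muln1 -(card_imset _ inj); apply: eq_card => -[x y].
  rewrite lhE f1 eqxx andbT; apply/andP/imsetP => [[/eqP -> lt]|[z]].
    by exists y; rewrite ?inE.
  by rewrite inE => lt [-> ->]; rewrite eqxx lt.
have disj : (low f :|: high f) :&: mid = set0.
  apply/setP => -[x y]; rewrite !inE /=; case: (boolP [&& B x == B y, _ & _]) => //= /and3P[bxy yx _].
  by have := sumE bxy; rewrite -!(inj_eq val_inj) /=; lia.
have := cardsUI (low f :|: high f) mid; rewrite disj cards0.
have := cardsUI (low f) (high f); rewrite interE midE; lia.
Qed.

End Pairs.

(** * Strips *)

Section AlternatingPath.

Variables (n : nat) (M : bool -> 'I_n -> 'I_n).
Hypothesis MK : forall c, involutive (M c).
Variables (v : nat -> 'I_n) (c : bool).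
Hypothesis vP : alternating_path M v c.

Lemma alternating_rev : 0 < n -> alternating_path M (fun i => v (n.-1 - i)) (c (+) odd n).
Proof.
move=> n_gt0; split.
- by move=> i j im jm /(alt_inj vP); lia.
- move=> x; have [i im <-] := alt_surj vP x; exists (n.-1 - i); first lia.
  by congr v; lia.
- move=> i im.
  have := alt_step vP (i := n.-1 - i.+1); have -> : (n.-1 - i.+1).+1 = n.-1 - i by lia.
  have -> : c (+) odd (n.-1 - i.+1) = c (+) odd n (+) odd i by lia.
  by move=> <-; [rewrite MK | lia].
- rewrite subn0; have -> : ~~ (c (+) odd n) = c (+) odd n.-1 by lia.
  exact: alt_last vP.
- rewrite subnn; have -> : c (+) odd n (+) odd n.-1 = ~~ c by lia.
  exact: alt_first vP.
Qed.

Lemma alternating_up i : i < n ->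
  M (c (+) odd i) (v i) = v (if i.+1 < n then i.+1 else i).
Proof.
move=> im; case: ifP => [|ge]; first exact: alt_step vP i.
have -> : i = n.-1 by lia.
exact: alt_last vP.
Qed.

Lemma alternating_down i : i < n -> M (c (+) ~~ odd i) (v i) = v i.-1.
Proof.
case: i => [|i] im /=; first by rewrite addbT; exact: alt_first vP.
by rewrite negbK -(alt_step vP im) MK.
Qed.

(** The fixed points are the path ends that lack colour [d]. If [n = 1] the two ends coincide, but
    then the two conditions on [d] exclude each other. *)
Lemma card_fixed d : 0 < n ->
  #|centers (M d)| = (d == ~~ c) + (d == (c (+) odd n.-1)).
Proof.
move=> n_gt0; have n1 : n.-1 < n by rewrite prednK.
have fixE x : (M d x == x) = (x == v 0) && (d == ~~ c) || (x == v n.-1) && (d == (c (+) odd n.-1)).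
  apply/eqP/orP => [|[/andP[/eqP -> /eqP ->]|/andP[/eqP -> /eqP ->]]]; last 2 first.
  - exact: alt_first vP.
  - exact: alt_last vP.
  have [i im <-] := alt_surj vP x.
  case: (eqVneq d (c (+) odd i)) => [->|dn].
    rewrite alternating_up //; case: ifP => ge e; first by have := alt_inj vP ge im e; lia.
    have iE : i = n.-1 by lia.
    by right; rewrite iE !eqxx.
  have dE : d = c (+) ~~ odd i by move: dn; case: d; case: c; case: (odd i).
  rewrite dE alternating_down // => e.
  have i0 : i = 0 by have := alt_inj vP _ im e; lia.
  by left; rewrite i0 eqxx /= addbT eqxx.
have -> : centers (M d) = (if d == ~~ c then [set v 0] else set0) :|:
    (if d == c (+) odd n.-1 then [set v n.-1] else set0).
  apply/setP => x; rewrite !inE fixE.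
  by case: (d == _); case: (d == _); rewrite ?inE ?andbT ?andbF ?orbF.
case: eqP => [e1|_]; case: eqP => [e2|_]; rewrite ?set0U ?setU0 ?cards0 ?cards1 //.
rewrite cards2; case: eqP => // /(alt_inj vP n_gt0 n1) e.
by move: e2; rewrite e1 -e; case: (c).
Qed.

End AlternatingPath.

(* Both sides count the blocks, by their middles and by their last vertices.  *)
Lemma card_block_ends n (M : 'I_n -> 'I_n) (B : 'I_n -> nat) : 0 < n -> rainbow M B ->
  #|[set x : 'I_n | M x == x.+1 :> nat]| + #|centers M| =
  #|[set x : 'I_n | [exists y : 'I_n, (y == x.+1 :> nat) && (B x != B y)]]| + 1.
Proof.
move=> n_gt0 MB; set caps := [set x : 'I_n | _ == _]; set bds := [set x | [exists y, _]].
have MK := rainbowK MB.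
have capsU : #|caps :|: centers M| = #|caps| + #|centers M|.
  rewrite cardsU disjoint_setI0 ?cards0 ?subn0 // -setI_eq0; apply/eqP/setP => x.
  by rewrite !inE -(inj_eq val_inj) /=; lia.
have topP : n.-1 < n by rewrite prednK.
pose top := Ordinal topP.
have bdsU : #|bds :|: [set top]| = #|bds| + 1.
  rewrite cardsU disjoint_setI0 ?cards0 ?subn0 ?cards1 // -setI_eq0; apply/eqP/setP => x.
  rewrite !inE; apply/andP => -[/existsP[y /andP[/eqP yx _]] /eqP xt].
  by move: (ltn_ord y); rewrite yx xt /=; lia.
rewrite -capsU -bdsU.
have lastP (x y : 'I_n) : x \in bds :|: [set top] -> B x = B y -> y <= x.
  rewrite !inE => /orP[/existsP[z /andP[/eqP zx ne]]|/eqP ->] e; last first.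
    by move: (ltn_ord y); rewrite /=; lia.
  rewrite leqNgt; apply/negP => xy; move/eqP: ne; apply.
  have := rainbow_mono MB (x := x) (y := z); have := rainbow_mono MB (x := z) (y := y).
  by rewrite zx xy e; lia.
have half_lt (x : 'I_n) : (M x + x)./2 < n.
  by have := ltn_ord x; have := ltn_ord (M x); lia.
(* Rounding down gives the center of an odd block and the left vertex of the innermost arc of an
   even one. *)
pose mid x := Ordinal (half_lt x).
have midB x : B (mid x) = B x.
  have := rainbow_block MB x.
  case: (leqP (M x) x) => le e.
  - have := rainbow_mono MB (x := M x) (y := mid x); have := rainbow_mono MB (x := mid x) (y := x).
    by rewrite /=; lia.
  - have := rainbow_mono MB (x := x) (y := mid x); have := rainbow_mono MB (x := mid x) (y := M x).
    by rewrite /=; lia.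
have inj : {in bds :|: [set top] &, injective mid}.
  move=> x y xl yl e; have e' : B x = B y by rewrite -midB e midB.
  by apply/val_inj/eqP; rewrite eqn_leq (lastP _ _ xl e') (lastP _ _ yl (esym e')).
rewrite -(card_in_imset inj); apply: eq_card => z.
apply/idP/imsetP => [zc|[x xl ->]]; last first.
  have := rainbow_sum MB (midB x); rewrite !inE -(inj_eq val_inj) /=; lia.
case: (@arg_maxnP _ z (fun y => B y == B z) (@nat_of_ord n)) => // x /eqP xz xmax.
exists x; last first.
  apply/val_inj => /=; have := rainbow_sum MB xz.
  by move: zc; rewrite !inE -(inj_eq val_inj) /=; lia.
rewrite !inE; case: (eqVneq x top) => [_|xt]; first by rewrite orbT.
have xn : x.+1 < n.
  by move: xt; rewrite -(inj_eq val_inj) /=; have := ltn_ord x; lia.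
rewrite orbF; apply/existsP; exists (Ordinal xn); rewrite eqxx /=.
apply/eqP => e; have := xmax (Ordinal xn); rewrite -e xz eqxx => /(_ isT) /=.
by rewrite ltnn.
Qed.

Section Strips.

Variables (n : nat) (M : bool -> 'I_n -> 'I_n) (B : bool -> 'I_n -> nat) (h : 'I_n -> int).
Hypothesis MB : forall c, rainbow (M c) (B c).
Hypothesis hM : forall c (x : 'I_n), x < M c x -> h (M c x) = (h x + (if c then -1 else 1))%R.

Let MK c : involutive (M c) := rainbowK (MB c).

(* A state (r, l) is a gap between two neighbouring vertices together with a  *)
(* direction of travel through it, r being on the right: we move up when r is *)
(* east of l and down otherwise.                                              *)
Definition gap (p : 'I_n * 'I_n) : bool := (p.1.+1 == p.2) || (p.2.+1 == p.1).
Definition up (p : 'I_n * 'I_n) : bool := p.2 < p.1.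
Definition inner (p : 'I_n * 'I_n) : bool := B (up p) p.1 == B (up p) p.2.
Definition swap (p : 'I_n * 'I_n) : 'I_n * 'I_n := (p.2, p.1).
Definition rise (p : 'I_n * 'I_n) : int := (h p.1 - h p.2)%R.

(** Both sides cross their arcs on the side of the line being entered; at a block boundary the
    traveller turns back instead. Non-gaps are fixed, which makes [advance] an injection of a finite
    type. *)
Definition advance (p : 'I_n * 'I_n) : 'I_n * 'I_n :=
  if gap p then if inner p then (M (up p) p.1, M (up p) p.2) else swap p else p.

(** For a gap this covers two events: turning back at a block boundary, and passing under an
    innermost arc, whose ends [M] exchanges. *)
Definition exit (p : 'I_n * 'I_n) : bool := advance p == swap p.
Definition cap_start (p : 'I_n * 'I_n) : bool := gap p && (M (~~ up p) p.1 == p.2).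

Lemma gap_swap p : gap (swap p) = gap p.
Proof. by rewrite /gap /= orbC. Qed.

Lemma up_swap p : gap p -> up (swap p) = ~~ up p.
Proof. by rewrite /gap /up /=; lia. Qed.

Lemma gap_up p : gap p -> (if up p then p.1 = p.2.+1 :> nat else p.2 = p.1.+1 :> nat).
Proof. by rewrite /gap /up; case: ltnP; lia. Qed.

Lemma rainbow_gap c (p : 'I_n * 'I_n) : gap p -> B c p.1 = B c p.2 ->
  gap (M c p.1, M c p.2) /\ up (M c p.1, M c p.2) = ~~ up p.
Proof.
move=> gp e; have := rainbow_sum (MB c) e; move: gp; rewrite /gap /up /=; lia.
Qed.

Lemma gap_advance p : gap (advance p) = gap p.
Proof.
rewrite /advance; case: ifP => // gp; case: ifP => [/eqP e|_]; last by rewrite gap_swap.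
by case: (rainbow_gap gp e).
Qed.

Lemma up_advance p : gap p -> up (advance p) = ~~ up p.
Proof.
move=> gp; rewrite /advance gp; case: ifP => [/eqP e|_]; last by rewrite up_swap.
by case: (rainbow_gap gp e).
Qed.

(** Time reversal: [swap] conjugates [advance] to its inverse, hence injectivity. *)
Lemma advance_swap_advance p : advance (swap (advance p)) = swap p.
Proof.
case: (boolP (gap p)) => gp; last by rewrite /advance (negPf gp) gap_swap (negPf gp).
have gn : gap (swap (advance p)) by rewrite gap_swap gap_advance.
have un : up (swap (advance p)) = up p by rewrite up_swap ?gap_advance // up_advance // negbK.
rewrite {1}/advance gn /inner un /advance gp; case: (boolP (inner p)) => [ip|ne] /=.
  have /eqP e := ip; rewrite !(rainbow_block (MB _)) e eqxx !MK; by case: (p).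
by have := ne; rewrite /inner => /negPf ->; case: (p).
Qed.

Lemma advance_inj : injective advance.
Proof.
move=> p q e; have := advance_swap_advance p; rewrite e advance_swap_advance => /(congr1 swap).
by case: p q {e} => [? ?] [? ?].
Qed.

Lemma exit_swap_advance p : exit (swap (advance p)) = exit p.
Proof.
rewrite /exit advance_swap_advance [RHS]eq_sym; congr (_ == _).
by case: (advance p).
Qed.

Lemma cap_start_swap p : cap_start p -> exit (swap p) && inner (swap p).
Proof.
move=> /andP[gp /eqP e]; rewrite /exit /advance gap_swap gp.
have i : inner (swap p) by rewrite /inner up_swap //= -e (rainbow_block (MB _)).
rewrite i andbT /= up_swap // -e MK e eqxx.
by case: p {gp i e}.
Qed.

Lemma swap_cap_start p : gap p -> exit p -> inner p -> cap_start (swap p).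
Proof.
move=> gp; rewrite /exit /advance gp => ep ip; move: ep; rewrite ip => /eqP[e _].
by rewrite /cap_start gap_swap gp up_swap // negbK /= -e MK.
Qed.

Lemma height_cases c (x : 'I_n) :
  [\/ x < M c x /\ h (M c x) = (h x + (if c then -1 else 1))%R,
      M c x < x /\ h (M c x) = (h x - (if c then -1 else 1))%R
    | M c x = x :> nat /\ h (M c x) = h x].
Proof.
case: (ltngtP x (M c x)) => [lt|lt|e]; 
  last by constructor 3; split=> //; congr h; apply/val_inj.
- by constructor 1; split=> //; apply: hM.
- by constructor 2; split=> //; have := @hM c (M c x); rewrite MK => /(_ lt) ->; rewrite addrK.
Qed.

Lemma exitE p : gap p -> inner p -> exit p = (M (up p) p.1 == p.2).
Proof.
move=> gp ip; rewrite /exit /advance gp ip; apply/eqP/eqP => [[]//|e].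
by rewrite /swap -e MK.
Qed.

Lemma not_exit_inner p : gap p -> ~~ exit p -> inner p.
Proof.
by move=> gp; apply: contraNT => ip; rewrite /exit /advance gp (negPf ip).
Qed.

(** Away from exits both sides cross arcs in the same horizontal direction and change height alike,
    unless one is a center and stays put. Then the difference gains 1, whichever side it is. *)
Lemma rise_advance p : gap p -> ~~ exit p ->
  rise (advance p) = (rise p + (M (up p) p.1 == p.1)%:Z + (M (up p) p.2 == p.2)%:Z)%R.
Proof.
move=> gp ne; have ip := not_exit_inner gp ne; rewrite exitE // in ne.
rewrite /advance gp ip /rise /=.
have e := rainbow_sum (MB (up p)) (eqP ip); have gu := gap_up gp.
rewrite -(inj_eq val_inj) /= in ne; rewrite -!(inj_eq val_inj (M _ _)) /=.
have [[l1 ->]|[l1 ->]|[l1 ->]] := height_cases (up p) p.1;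
  have [[l2 ->]|[l2 ->]|[l2 ->]] := height_cases (up p) p.2;
  case: (up p) e ne gu l1 l2 => /= e ne gu l1 l2; lia.
Qed.

Lemma rise_cap p : gap p -> inner p -> exit p -> rise p = (-1)%R.
Proof.
move=> gp ip; rewrite exitE // => /eqP e; have gu := gap_up gp; rewrite /rise.
by have := height_cases (up p) p.1; rewrite e; case: (up p) gu => gu [[]|[]|[]]; lia.
Qed.

Lemma rise_swap p : rise (swap p) = (- rise p)%R.
Proof. by rewrite /rise opprB. Qed.

Lemma rise_cap_start p : cap_start p -> rise p = 1%R.
Proof.
move=> sp; have /andP[gp _] := sp; have /andP[e i] := cap_start_swap sp.
by have := rise_cap _ i e; rewrite gap_swap rise_swap => /(_ gp); lia.
Qed.

Lemma rise_inner_abs c (p : 'I_n * 'I_n) : M c p.1 = p.2 -> (rise p <= 1)%R.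
Proof.
move=> e; rewrite /rise; have := height_cases c p.1; rewrite e.
by case=> -[_ ->]; case: (c); lia.
Qed.

Lemma gap_iter k p : gap (iter k advance p) = gap p.
Proof. by elim: k => //= k IH; rewrite gap_advance. Qed.

Lemma up_iter k p : gap p -> up (iter k advance p) = up p (+) odd k.
Proof.
move=> gp; elim: k => [|k IH]; first by rewrite addbF.
by rewrite iterS up_advance ?gap_iter // IH addbN.
Qed.

Section Positions.

Variables (v : nat -> 'I_n) (c : bool).
Hypothesis vP : alternating_path M v c.

(* Positions on the path v of the two sides of a strip after k steps, when it *)
(* starts at the innermost arc between v s.-1 and v s. Each side runs along   *)
(* the path and turns back at its end; the formulas are right for k < n.      *)
Definition right_pos (s k : nat) : nat := if s + k < n then s + k else n.*2 - 1 - s - k.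
Definition left_pos (s k : nat) : nat := if k < s then s.-1 - k else k - s.

Variables (p : 'I_n * 'I_n) (s : nat).
Hypotheses (pS : cap_start p) (s_gt0 : 0 < s) (sn : s < n).
Hypotheses (p1 : p.1 = v s) (p2 : p.2 = v s.-1).

Let gp : gap p. Proof. by case/andP: pS. Qed.

Lemma cap_start_up : up p = c (+) odd s.
Proof.
have /andP[_ /eqP] := pS; rewrite p1 p2.
case: (eqVneq (up p) (c (+) odd s)) => // ne.
have -> : ~~ up p = c (+) odd s by move: ne; case: (up p); case: (c (+) odd s).
rewrite (alternating_up vP) //; case: ifP => ls /(alt_inj vP) e; lia.
Qed.

Lemma trajectory k : k < n -> (forall i, i < k -> ~~ exit (iter i advance p)) ->
  iter k advance p = (v (right_pos s k), v (left_pos s k)) /\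
  rise (iter k advance p) = (1 + (n - s <= k)%:Z + (s <= k)%:Z)%R.
Proof.
elim: k => [|k IH] kn ne.
  rewrite /= rise_cap_start // /right_pos /left_pos addn0 sn s_gt0 subn0; split.
    by rewrite -p1 -p2; case: (p).
  by lia.
have [||e d] := IH; first lia; first by move=> i ik; apply: ne; lia.
have nk := ne k (ltnSn k).
have gk : gap (iter k advance p) by rewrite gap_iter.
have ik := not_exit_inner gk nk.
have uk : up (iter k advance p) = c (+) odd (s + k).
  by rewrite up_iter // cap_start_up oddD addbA.
have Mr : M (c (+) odd (s + k)) (v (right_pos s k)) = v (right_pos s k.+1).
  rewrite /right_pos addnS; case: ltnP => sk.
    rewrite (alternating_up vP) //; case: ltnP => sk'; congr v; lia.
  have -> : odd (s + k) = ~~ odd (n.*2 - 1 - s - k) by lia.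
  rewrite (alternating_down MK vP); last by lia.
  by rewrite ltnNge (leq_trans sk (leqnSn _)) /=; congr v; lia.
have Ml : M (c (+) odd (s + k)) (v (left_pos s k)) = v (left_pos s k.+1).
  rewrite /left_pos; case: ltnP => sk.
    have -> : odd (s + k) = ~~ odd (s.-1 - k) by lia.
    rewrite (alternating_down MK vP); last by lia.
    by case: ltnP => sk'; congr v; lia.
  have -> : odd (s + k) = odd (k - s) by lia.
  rewrite (alternating_up vP); last by lia.
  have -> : (k - s).+1 < n by lia.
  by rewrite [k.+1 < s]ltnNge (leq_trans sk (leqnSn _)) /=; congr v; lia.
split; first by rewrite iterS {1}/advance gk ik uk e /= Mr Ml.
have rn i : i < n -> right_pos s i < n by rewrite /right_pos; case: ifP; lia.
have ln i : i < n -> left_pos s i < n by rewrite /left_pos; case: ifP; lia.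
have vE i j : i < n -> j < n -> (v i == v j) = (i == j).
  by move=> im jm; apply/eqP/eqP => [/(alt_inj vP)->|->].
rewrite iterS rise_advance // d uk e /= Mr Ml !vE ?rn ?ln //; try exact: ltnW.
have -> : (right_pos s k.+1 == right_pos s k) = (k.+1 == n - s).
  by rewrite /right_pos; case: ltnP => ?; case: ltnP => ?; lia.
have -> : (left_pos s k.+1 == left_pos s k) = (k.+1 == s).
  by rewrite /left_pos; case: ltnP => ?; case: ltnP => ?; lia.
rewrite [n - s <= k.+1]leq_eqVlt [s <= k.+1]leq_eqVlt !ltnS ![_ == k.+1]eq_sym.
by case: (k.+1 =P n - s) => [e1|_]; case: (k.+1 =P s) => [e2|_] /=; lia.
Qed.

(** At step [n.-1] the two sides would be consecutive on the path, hence of rise at most 1, whereas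
    both ends have been passed and the rise is 3. *)
Lemma trajectory_bound k : (forall i, i < k -> ~~ exit (iter i advance p)) -> k.+1 < n.
Proof.
move=> ne; rewrite ltnNge; apply/negP => kn.
have [||e d] := @trajectory n.-1; first lia; first by move=> i ik; apply: ne; lia.
have vE i j : i < n -> j < n -> (v i == v j) = (i == j).
  by move=> im jm; apply/eqP/eqP => [/(alt_inj vP)->|->].
have rE : right_pos s n.-1 = n - s by rewrite /right_pos; case: ifP; lia.
have lE : left_pos s n.-1 = (n - s).-1 by rewrite /left_pos; case: ifP; lia.
rewrite rE lE in e.
have := @rise_inner_abs (c (+) ~~ odd (n - s)) (iter n.-1 advance p).
rewrite d e /= (alternating_down MK vP) => [/(_ erefl)|]; lia.
Qed.

End Positions.
End Strips.

(** * Every gap lies on a strip from an innermost arc *)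

Section Cover.

Variables (n : nat) (M : bool -> 'I_n -> 'I_n) (B : bool -> 'I_n -> nat) (h : 'I_n -> int).
Hypotheses (n_gt0 : 0 < n) (MB : forall c, rainbow (M c) (B c)).
Hypothesis hM : forall c (x : 'I_n), x < M c x -> h (M c x) = (h x + (if c then -1 else 1))%R.
Variables (v0 : nat -> 'I_n) (c0 : bool).
Hypothesis v0P : alternating_path M v0 c0.

Let MK c : involutive (M c) := rainbowK (MB c).
Local Notation adv := (advance M B).
Local Notation stop := (exit M B).
Local Notation inn := (inner B).
Local Notation cap := (cap_start M).
Local Notation rs := (rise h).

Lemma rise_advance_le p : gap p -> ~~ stop p -> (rs p <= rs (adv p))%R.
Proof. by move=> gp ne; rewrite (rise_advance MB hM) //; lia. Qed.

Lemma orient p d : exists v c t, [/\ alternating_path M v c, t < n, p = v t & d = c (+) odd t].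
Proof.
have [t tn <-] := alt_surj v0P p.
case: (eqVneq d (c0 (+) odd t)) => [dE|dn]; first by exists v0, c0, t.
exists (fun i => v0 (n.-1 - i)), (c0 (+) odd n), (n.-1 - t); split.
- exact: (alternating_rev MK v0P n_gt0).
- lia.
- by congr v0; lia.
- by move: dn; lia.
Qed.

(** Without an early exit the right side walks along the path to its end, where the next step
    strictly increases the rise. The rise never decreases before an exit, yet the orbit of an
    injection of a finite type returns to its start. *)
Lemma exit_exists p : gap p -> exists k, stop (iter k adv p).
Proof.
move=> gp; case: (boolP [exists i : 'I_n, stop (iter i adv p)]) => [/existsP[i]|]; first by exists i.
move=> /existsPn ne0.
have [v [c [t [vP tn p1 up_p]]]] := orient p.1 (up p).
have pos i : t + i < n -> (iter i adv p).1 = v (t + i).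
  elim: i => [|i IH] tin; first by rewrite addn0.
  have tin' : t + i < n by lia.
  have i_n : i < n by lia.
  have nei := ne0 (Ordinal i_n).
  have gi : gap (iter i adv p) by rewrite (gap_iter MB).
  rewrite iterS {1}/advance gi (not_exit_inner gi nei) /= IH //.
  rewrite (up_iter MB) // up_p -addbA -oddD (alternating_up vP) //.
  by rewrite -addnS tin.
pose q := iter (n.-1 - t) adv p.
have gq : gap q by rewrite (gap_iter MB).
have qE : q.1 = v n.-1 by rewrite /q pos; [congr v; lia | lia].
have uq : up q = c (+) odd n.-1.
  by rewrite (up_iter MB) // up_p -addbA -oddD; congr (c (+) odd _); lia.
have lt_q : ~~ stop q -> (rs q < rs (adv q))%R.
  move=> nq; rewrite (rise_advance MB hM) // qE uq (alt_last vP) eqxx; lia.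
have q_order := iter_order (advance_inj MB) q.
case: (boolP [exists i : 'I_(order adv q), stop (iter i adv q)]) => [/existsP[i ei]|/existsPn ne].
  by exists (i + (n.-1 - t)); rewrite iterD.
have o_gt0 := order_gt0 adv q.
have lt1 := lt_q (ne (Ordinal o_gt0)).
have : (rs (adv q) <= rs (iter (order adv q) adv q))%R.
  have : forall j, j < order adv q -> (rs (adv q) <= rs (iter j.+1 adv q))%R.
    elim=> [//|j IH] jo; apply: le_trans (IH (ltnW jo)) _; rewrite [iter j.+2 _ _]iterS.
    by apply: rise_advance_le; rewrite ?(gap_iter MB) //; apply: (ne (Ordinal jo)).
  by move/(_ (order adv q).-1); rewrite prednK //; apply.
by rewrite q_order; move: lt1; lia.
Qed.

Definition first_exit p k := stop (iter k adv p) /\ forall i, i < k -> ~~ stop (iter i adv p).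

Lemma first_exit_exists p : gap p -> exists k, first_exit p k.
Proof.
move=> gp; have [k kP kmin] := ex_minnP (exit_exists gp).
by exists k; split=> // i ik; apply/negP => /kmin; lia.
Qed.

Lemma cap_start_orient p : cap p -> exists v c s,
  [/\ alternating_path M v c, 0 < s, s < n, p.1 = v s & p.2 = v s.-1].
Proof.
move=> pS; have /andP[gp /eqP e] := pS.
have ne : p.1 != p.2 by rewrite -(inj_eq val_inj); move: gp; rewrite /gap /=; lia.
have [v [c [s [vP sn p1 up_p]]]] := orient p.1 (up p).
exists v, c, s; have dE : ~~ up p = c (+) ~~ odd s by rewrite up_p addbN.
have p2 : p.2 = v s.-1 by rewrite -e p1 dE (alternating_down MK vP).
by split=> //; case: (s) p1 p2 => // p1 p2; move: ne; rewrite p1 p2 eqxx.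
Qed.

Lemma cap_start_rise p k : cap p -> (forall i, i < k -> ~~ stop (iter i adv p)) ->
  (1 <= rs (iter k adv p))%R.
Proof.
move=> pS; have /andP[gp _] := pS.
elim: k => [|k IH] ne; first by rewrite /= (rise_cap_start MB hM).
apply: le_trans (IH _) _; first by move=> i ik; apply: ne; lia.
by rewrite iterS; apply: rise_advance_le; rewrite ?(gap_iter MB) //; apply: ne.
Qed.

Lemma cap_start_exit p k : cap p -> first_exit p k -> ~~ inn (iter k adv p).
Proof.
move=> pS [ek ne]; apply/negP => ik; have := cap_start_rise pS ne.
by rewrite (rise_cap MB hM) // (gap_iter MB); case/andP: pS.
Qed.

(** Add [card_block_ends] over both colours: the two centers, which are the path ends, cancel the
    two extra units. *)
Lemma card_starts_exits :
  #|[set p | cap p]| = #|[set p | gap p && ~~ inn p]|.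
Proof.
pose low (p : 'I_n * 'I_n) := if up p then p.2 else p.1.
pose mk d (x y : 'I_n) := if d then (y, x) else (x, y).
have gE (p : 'I_n * 'I_n) : gap p -> exists x y : 'I_n, y = x.+1 :> nat /\ p = mk (up p) x y.
  move=> gp; have := gap_up gp; rewrite /mk; case: (up p) => e; [exists p.2, p.1 | exists p.1, p.2];
    by split=> //; case: (p).
have mkP d (x y : 'I_n) : y = x.+1 :> nat -> [/\ gap (mk d x y), up (mk d x y) = d & low (mk d x y) = x].
  by move=> e; rewrite /low /gap /up; case: d => /=; rewrite ?e ?ltnSn ?eqxx ?orbT // ltnNge leqnSn.
have low_inj d : {in [set p | gap p && (up p == d)] &, injective low}.
  move=> p q; rewrite !inE => /andP[/gE[x [y [e pE]]] /eqP ud] /andP[/gE[x' [y' [e' qE]]] /eqP ud'].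
  rewrite ud in pE; rewrite ud' in qE; rewrite pE qE.
  have [_ _ ->] := mkP d x y e; have [_ _ ->] := mkP d x' y' e' => xx.
  rewrite -xx in e' *.
  by have -> : y = y' by apply/val_inj; rewrite /= e e'.
have split_up (P : pred ('I_n * 'I_n)) : #|[set p | P p]| = \sum_(d : bool) #|[set p | P p && (up p == d)]|.
  rewrite big_bool /= -cardsUI; have -> : [set p | P p && (up p == true)] :&: [set p | P p && (up p == false)] = set0.
    by apply/setP => p; rewrite !inE; case: (up p); rewrite ?andbF.
  rewrite cards0 addn0; apply: eq_card => p; rewrite !inE.
  by case: (up p); rewrite ?andbF ?andbT ?orbF.
have starts d : #|[set p | cap p && (up p == ~~ d)]| = #|[set x : 'I_n | M d x == x.+1 :> nat]|.
  rewrite -(card_in_imset (f := low)); last first.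
    move=> p q; rewrite !inE => /andP[/andP[gp _] up_p] /andP[/andP[gq _] up_q].
    by apply: (low_inj (~~ d)); rewrite inE ?gp ?gq.
  apply: eq_card => x; apply/imsetP/idP => [[p]|].
    rewrite !inE => /andP[/andP[/gE[z [y [e pE]]]]]; move: pE => ->.
    have [_ -> ->] := mkP (up p) z y e; move=> /eqP + /eqP ud.
    move=> + ->; rewrite ud negbK /mk.
    by case: (d) => /= H; [rewrite H e | rewrite -{1}H MK e].
  rewrite inE => /eqP e; exists (mk (~~ d) x (M d x)).
    have [g u _] := mkP (~~ d) x _ e.
    rewrite inE /cap_start g u negbK eqxx andbT /=.
    by rewrite /mk; case: (d); rewrite /= ?MK.
  by have [_ _ ->] := mkP (~~ d) x _ e.
have exits d : #|[set p | (gap p && ~~ inn p) && (up p == d)]| =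
    #|[set x : 'I_n | [exists y : 'I_n, (y == x.+1 :> nat) && (B d x != B d y)]]|.
  rewrite -(card_in_imset (f := low)); last first.
    move=> p q; rewrite !inE => /andP[/andP[gp _] up_p] /andP[/andP[gq _] up_q].
    by apply: (low_inj d); rewrite inE ?gp ?gq.
  apply: eq_card => x; apply/imsetP/idP => [[p]|].
    rewrite !inE => /andP[/andP[/gE[z [y [e pE]]]]]; move: pE => ->.
    rewrite /inner; have [_ -> ->] := mkP (up p) z y e; move=> + /eqP ud ->.
    rewrite ud /mk => ne; apply/existsP; exists y; rewrite e eqxx /=.
    by move: ne; case: (d); rewrite //= eq_sym.
  rewrite inE => /existsP[y /andP[/eqP e ne]]; exists (mk d x y).
    have [g u _] := mkP d x _ e.
    by rewrite inE /inner g u eqxx andbT /=; move: ne; rewrite /mk; case: (d); rewrite //= eq_sym.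
  by have [_ _ ->] := mkP d x _ e.
rewrite !split_up !big_bool /=.
have := exits true; have := exits false; have := starts true; have := starts false.
rewrite /= => -> -> -> ->.
have := card_block_ends n_gt0 (MB true); have := card_block_ends n_gt0 (MB false).
rewrite !(card_fixed MK v0P) // => e1 e2.
have fix2 : (true == ~~ c0) + (true == (c0 (+) odd n.-1)) +
    ((false == ~~ c0) + (false == (c0 (+) odd n.-1))) = 2.
  by case: (c0); case: (odd _).
rewrite /= in e1 e2 fix2; lia.
Qed.

(** The only predecessor of a cap start is its own reversal, which is an exit; so no strip runs into
    a cap start before exiting. *)
Lemma cap_start_pred p i q : cap p -> iter i.+1 adv q = p -> stop (iter i adv q).
Proof.
move=> pS; have /andP[ex _] := cap_start_swap MB pS.
have es : adv (swap p) = p by rewrite (eqP ex); case: (p).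
by rewrite iterS -[p in _ = p]es => /(advance_inj MB) ->.
Qed.

Lemma iter_advance_inj j : injective (iter j adv).
Proof. by elim: j => [|j IH] p q //= /(advance_inj MB) /IH. Qed.

(* Sending a cap to the first exit of its strip is injective, and caps and    *)
(* boundary exits are equinumerous.                                           *)
Lemma exit_from_cap z : gap z -> ~~ inn z -> exists p k,
  [/\ cap p, first_exit p k & iter k adv p = z].
Proof.
move=> gz iz.
have /fin_all_exists[k kP] : forall p, exists k, cap p -> first_exit p k.
  move=> p; case: (boolP (cap p)) => [pS|_]; last by exists 0.
  by have /andP[gp _] := pS; have [k kP] := first_exit_exists gp; exists k.
pose e p := iter (k p) adv p.
have inj : {in [set p | cap p] &, injective e}.
  have wlg p q : cap p -> cap q -> k p <= k q -> e p = e q -> p = q.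
    move=> pS qS pq; rewrite /e -(subnKC pq) iterD => /iter_advance_inj.
    case E : (k q - k p) => [//|i] /esym/(cap_start_pred pS) ex.
    by have [_ /(_ i)] := kP q qS; rewrite ex => H; have : false by apply: H; lia.
  move=> p q; rewrite !inE => pS qS epq; case/orP: (leq_total (k p) (k q)) => le.
    exact: wlg.
  by apply/esym/wlg.
have sub : [set e p | p in [set p | cap p]] \subset [set p | gap p && ~~ inn p].
  apply/subsetP => _ /imsetP[p pS ->]; rewrite !inE in pS *.
  rewrite /e (gap_iter MB); have /andP[-> _] := pS.
  exact: cap_start_exit pS (kP p pS).
have /eqP/setP/(_ z) : [set e p | p in [set p | cap p]] == [set p | gap p && ~~ inn p].
  by rewrite eqEcard sub /= (card_in_imset inj) card_starts_exits.
rewrite inE gz iz => /imsetP[p]; rewrite inE => pS zE.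
by exists p, (k p); split=> //; exact: kP.
Qed.

(** Follow [x] to its first exit. If that is an innermost arc, the reversed walk starts there and
    meets [swap x]. If it is a boundary, a strip from a cap ends in the same exit, and by
    injectivity it contains [x]. *)
Lemma gap_from_cap x : gap x -> exists p k, [/\ cap p,
  forall i, i < k -> ~~ stop (iter i adv p) &
  iter k adv p = x \/ iter k adv p = swap x].
Proof.
move=> gx; have [k [ek ne]] := first_exit_exists gx.
set z := iter k adv x; have gz : gap z by rewrite (gap_iter MB).
case: (boolP (inn z)) => iz.
  have rev i : i <= k -> iter i adv (swap z) = swap (iter (k - i) adv x).
    elim: i => [|i IH] ik; first by rewrite subn0.
    rewrite iterS IH; last by lia.
    have -> : k - i = (k - i.+1).+1 by lia.
    by rewrite iterS (advance_swap_advance MB).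
  exists (swap z), k; split; first exact: (swap_cap_start MB).
    move=> i ik; rewrite rev; last exact: ltnW.
    have -> : k - i = (k - i.+1).+1 by lia.
    by rewrite iterS (exit_swap_advance MB); apply: ne; lia.
  by right; rewrite rev ?subnn.
have [p [k' [pS [_ ne'] zE]]] := exit_from_cap gz iz; exists p.
case: (leqP k k') => kk.
  exists (k' - k); split=> //; first by move=> i ik; apply: ne'; lia.
  by left; move: zE; rewrite /z -(subnKC kk) iterD => /iter_advance_inj; rewrite addKn.
move: zE; rewrite /z -(subnKC kk) addSnnS iterD => /iter_advance_inj/esym/(cap_start_pred pS) ex.
by have := ne (k - k'.+1); rewrite ex => H; have : false by apply: H; lia.
Qed.

(* What is known after following k steps from an innermost arc: each end of   *)
(* the path that the strip has passed adds 1 to the height difference.        *)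
Definition strip (v : nat -> 'I_n) (s k : nat) : Prop :=
  [/\ 0 < s < n, k.+1 < n,
      forall i, i <= k -> gap (v (right_pos n s i), v (left_pos s i)) /\
        rs (v (right_pos n s i), v (left_pos s i)) = (1 + (n - s <= i)%:Z + (s <= i)%:Z)%R,
      forall i c, i < k -> B c (v (right_pos n s i)) = B c (v (left_pos s i)) &
      forall i c, 0 < i < k ->
        M c (v (right_pos n s i)) <> v (left_pos s i) /\
        exists2 j, j = i.+1 \/ j = i.-1 &
          M c (v (right_pos n s i)) = v (right_pos n s j) /\
          M c (v (left_pos s i)) = v (left_pos s j)].

Lemma strip_cover x : gap x -> exists v c s k, [/\ alternating_path M v c, strip v s k &
  x = (v (right_pos n s k), v (left_pos s k)) \/ swap x = (v (right_pos n s k), v (left_pos s k))].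
Proof.
move=> gx; have [p [k [pS ne px]]] := gap_from_cap gx.
have [v [c [s [vP s_gt0 sn p1 p2]]]] := cap_start_orient pS.
have kn := trajectory_bound MB hM vP pS s_gt0 sn p1 p2 ne.
have gp i : gap (iter i adv p) by rewrite (gap_iter MB); case/andP: pS.
have tr i : i <= k -> iter i adv p = (v (right_pos n s i), v (left_pos s i)) /\
    rs (iter i adv p) = (1 + (n - s <= i)%:Z + (s <= i)%:Z)%R.
  move=> ik; apply: (trajectory MB hM vP pS s_gt0 sn p1 p2); first lia.
  by move=> j ji; apply: ne; lia.
have inE i : i < k -> inn (iter i adv p) by move=> ik; apply: (not_exit_inner (gp i)); apply: ne.
have nextE i : i < k -> let c' := up (iter i adv p) in
    M c' (v (right_pos n s i)) = v (right_pos n s i.+1) /\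
    M c' (v (left_pos s i)) = v (left_pos s i.+1).
  move=> ik c'; have [e _] := tr i (ltnW ik); have [e' _] := tr i.+1 ik.
  move: e'; rewrite iterS {1}/advance gp inE // -/c' e /= => -[-> ->]; split=> //.
have prevE i : i.+1 < k -> let c' := up (iter i.+1 adv p) in
    M (~~ c') (v (right_pos n s i.+1)) = v (right_pos n s i) /\
    M (~~ c') (v (left_pos s i.+1)) = v (left_pos s i).
  move=> ik c'.
  have -> : ~~ c' = up (iter i adv p) by rewrite /c' iterS (up_advance MB) // negbK.
  by have [<- <-] := nextE i (ltnW ik); rewrite !MK.
exists v, c, s, k; split=> //; last first.
  have [e _] := tr k (leqnn k); rewrite -e.
  by case: px => ->; [left | right; case: (x)].
split=> //; first by rewrite s_gt0.
- by move=> i ik; have [<- ->] := tr i ik; rewrite gp.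
- move=> i d ik; have [e _] := tr i (ltnW ik); set c' := up (iter i adv p).
  (* The colour of travel leads to the next gap. The other colour leads back to the previous one,
     or, at step 0, is that of the starting arc. *)
  case: (eqVneq d c') => [->|dc]; first by have := eqP (inE i ik); rewrite -/c' e.
  have {dc}-> : d = ~~ c' by move: dc; case: (d); case: c'.
  case: i ik e @c' => [|i] ik e c'.
    have /andP[_ /eqP capE] := pS.
    have e1 := congr1 fst e; have e2 := congr1 snd e; rewrite /= in e1 e2.
    by rewrite -e1 -e2 -capE /c' /= (rainbow_block (MB _)).
  have [e1 e2] := prevE i ik; rewrite -/c' in e1 e2.
  have [e' _] := tr i (ltnW (ltnW ik)); have := eqP (inE i (ltnW ik)); rewrite e' /=.
  have -> : up (v (right_pos n s i), v (left_pos s i)) = ~~ c'.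
    by rewrite -e' /c' iterS (up_advance MB) // negbK.
  by rewrite -e1 -e2 !(rainbow_block (MB _)).
- move=> i d /andP[i_gt0 ik]; have [e _] := tr i (ltnW ik); set c' := up (iter i adv p).
  case: i i_gt0 ik e @c' => [//|i] _ ik e c'.
  case: (eqVneq d c') => [->|dc].
    have [e1 e2] := nextE _ ik; split; last by exists i.+2; [left|].
    move=> ee; have := ne _ ik; rewrite (exitE MB (gp _) (inE _ ik)) e /=.
    by rewrite -e -/c' ee eqxx.
  have {dc}-> : d = ~~ c' by move: dc; case: (d); case: c'.
  have [e1 e2] := prevE _ ik; split; last by exists i; [right|].
  rewrite -/c' in e1 e2; move=> ee; have := ne _ (ltnW ik).
  rewrite (exitE MB (gp _) (inE _ (ltnW ik))).
  have -> : up (iter i adv p) = ~~ c' by rewrite /c' iterS (up_advance MB) // negbK.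
  have [-> _] := tr i (ltnW (ltnW ik)); rewrite /= -e1 -e2 -ee.
  by rewrite eqxx.
Qed.

End Cover.

(** * Steep gaps *)

Section Steep.

Variables (n : nat) (M : bool -> 'I_n -> 'I_n) (B : bool -> 'I_n -> nat).
Hypothesis MK : forall c, involutive (M c).

(* Reversing the path exchanges the two sides of the strip.                   *)
Lemma strip_rev h v s k : strip M B h v s k ->
  strip M B (fun x => - h x)%R (fun i => v (n.-1 - i)) (n - s) k.
Proof.
move=> [sn kn gapP innP turnP].
have rE i : i < n -> n.-1 - right_pos n (n - s) i = left_pos s i.
  by move=> im; rewrite /right_pos /left_pos; case: ltnP => ?; case: ltnP => ?; lia.
have lE i : i < n -> n.-1 - left_pos (n - s) i = right_pos n s i.
  by move=> im; rewrite /right_pos /left_pos; case: ltnP => ?; case: ltnP => ?; lia.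
split; rewrite ?subKn //; try lia.
- move=> i ik; rewrite rE ?lE; try lia.
  have [g r] := gapP i ik.
  by move: g r; rewrite /gap /rise /=; lia.
- move=> i c ik; rewrite rE ?lE; try lia.
  by rewrite innP.
- move=> i c ik; rewrite rE ?lE; try lia.
  have [ne [j ij [e1 e2]]] := turnP i c ik.
  split; first by move=> e; apply: ne; rewrite -e MK.
  by exists j => //; rewrite rE ?lE; [split | lia | lia].
Qed.

Lemma gap_other (x y z w : 'I_n) : gap (x, y) -> gap (x, z) -> gap (x, w) ->
  y != z -> y != w -> z = w.
Proof.
rewrite /gap -!(inj_eq val_inj) /= => *; apply/val_inj => /=; lia.
Qed.

(* z is on the other side of y, in an earlier gap of the same strip.          *)
Lemma strip_steep h v s k : strip M B h v s k -> s <= n - s -> n - s <= k ->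
  exists z, let y := v (right_pos n s k) in
  [/\ gap (y, z), (1 <= h y - h z <= 2)%R &
      forall c, [/\ B c y = B c z, M c y != z &
                    M c y != y -> (`|h (M c y) - h (M c z)| <= 2)%R]].
Proof.
(* Step [j] is when the right side was at its present position before turning at [v n.-1]: it solves
   [s + j = n.*2 - 1 - s - k]. *)
move=> [sn kn gapP innP turnP] s2 ks; set j := n.*2 - 1 - s.*2 - k.
have rE : right_pos n s k = right_pos n s j.
  by rewrite /right_pos /j; case: ltnP => ?; case: ltnP => ?; lia.
have jk : j < k by rewrite /j; lia.
have [g r] := gapP j (ltnW jk).
exists (v (left_pos s j)); rewrite rE /=; split=> //.
  move: r; rewrite /rise /= => ->; have -> : (n - s <= j) = false by rewrite /j; lia.
  by case: (s <= j); lia.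
move=> c; have j_in : 0 < j < k by rewrite /j; lia.
have [ne [i ij [e1 e2]]] := turnP j c j_in; split; [exact: innP | exact/eqP |].
rewrite e1 e2 => ne1.
have ik : i <= k by lia.
have [_ ] := gapP i ik; rewrite /rise /= => ->.
have -> : (n - s <= i) = false.
  apply/negP => ni; have iE : i = n - s by rewrite /j in ij; lia.
  have jE : j = (n - s).-1 by lia.
  have e : right_pos n s i = right_pos n s j.
    by rewrite iE jE /right_pos; case: ltnP => ?; case: ltnP => ?; lia.
  by rewrite e eqxx in ne1.
by case: (s <= i); lia.
Qed.

(* When the strip has turned around v n.-1, walking away from that vertex     *)
(* crosses gaps of the same strip, and the vertex reached after m gaps has    *)
(* position n.-1 - 2sm, folded back at the start of the path.                 *)
Definition wrap_pos (s m : nat) : nat :=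
  if (s * m).*2 < n then n.-1 - (s * m).*2 else (s * m).*2 - n.

Lemma strip_walk h v s k m : strip M B h v s k -> s.*2 < n -> n - s <= k -> (s * m.+1).*2 < n.*2 ->
  [/\ gap (v (wrap_pos s m), v (wrap_pos s m.+1)),
      forall c, B c (v (wrap_pos s m)) = B c (v (wrap_pos s m.+1)) &
      (h (v (wrap_pos s m)) - h (v (wrap_pos s m.+1)))%R =
        (if ((s * m).*2 + s < n)%N then 1 + ((s * m.+1).*2 < n)%N%:Z
        else - (1 + (n <= (s * m).*2)%N%:Z))%R].
Proof.
move=> [sn kn gapP innP turnP] s2 ks; rewrite /wrap_pos mulnS; set q := s * m => mn.
case: (ltnP (q.*2 + s) n) => qn.
(* At step [o] the right side is at [wrap_pos s m] here, and at [wrap_pos s m.+1] in the other case,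
   where the crossing is therefore reversed. *)
- set o := n.-1 - q.*2 - s; have ok : o < k by rewrite /o; lia.
  have -> : q.*2 < n by lia.
  have [g r] := gapP o (ltnW ok); have inn c := innP o c ok.
  have rE : right_pos n s o = n.-1 - q.*2 by rewrite /right_pos /o; case: ltnP => ?; lia.
  have lE : left_pos s o = if (s + q).*2 < n then n.-1 - (s + q).*2 else (s + q).*2 - n.
    by rewrite /left_pos /o; case: ltnP => ?; case: ltnP => ?; lia.
  rewrite -rE -lE; split=> //; move: r; rewrite /rise /= => ->.
  have -> : (n - s <= o) = false by rewrite /o; lia.
  have -> : (s <= o) = ((s + q).*2 < n) by rewrite /o; lia.
  by rewrite addr0.
- set o := q.*2 + s - n; have ok : o < k by rewrite /o; lia.
  have -> : ((s + q).*2 < n) = false by lia.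
  have [g r] := gapP o (ltnW ok); have inn c := innP o c ok.
  have rE : right_pos n s o = (s + q).*2 - n by rewrite /right_pos /o; case: ltnP => ?; lia.
  have lE : left_pos s o = if q.*2 < n then n.-1 - q.*2 else q.*2 - n.
    by rewrite /left_pos /o; case: ltnP => ?; case: ltnP => ?; lia.
  rewrite -rE -lE; split=> //; first by move: g; rewrite /gap /= orbC.
  rewrite -opprB; move: r; rewrite /rise /= => ->.
  have -> : (n - s <= o) = false by rewrite /o; lia.
  have -> : (s <= o) = (n <= q.*2) by rewrite /o; lia.
  by rewrite addr0.
Qed.

(** The height drop from [v n.-1] climbs through even values, becomes odd at the single crossing of
    size 1, and descends by twos until it is 1. *)
Lemma strip_walk_height h v s k : strip M B h v s k -> s.*2 < n -> n - s <= k ->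
  exists2 m, (s * m).*2 < n.*2 & (h (v n.-1) - h (v (wrap_pos s m)) = 1)%R.
Proof.
move=> vS s2 ks; have [/andP[s_gt0 sn] _ _ _ _] := vS.
pose S m : int := (h (v n.-1) - h (v (wrap_pos s m)))%R.
have S0 : S 0 = 0%R.
  by rewrite /S /wrap_pos muln0 double0 (ltn_trans s_gt0 sn) subn0 subrr.
have SS m : (s * m.+1).*2 < n.*2 -> S m.+1 = (S m + (if ((s * m).*2 + s < n)%N
    then 1 + ((s * m.+1).*2 < n)%N%:Z else - (1 + (n <= (s * m).*2)%N%:Z)))%R.
  by move=> mn; have [_ _ e] := strip_walk vS s2 ks mn; rewrite -e /S; lia.
pose i := n.-1 %/ s.*2; pose j := n.-1 %% s.*2.
have nE : n.-1 = i * s.*2 + j := divn_eq _ _.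
have js : j < s.*2 by rewrite ltn_mod double_gt0.
clearbody i j.
have dE t : (s * t).*2 = t * s.*2 by rewrite doubleMl mulnC.
(* The height falls by 2 as long as the position has not been folded and then *)
(* rises by 2; the one crossing in between has difference 1.                  *)
have S1 m : m <= i -> S m = Posz m.*2.
  elim: m => [//|m IH] mi.
  have le : m.+1 * s.*2 <= i * s.*2 by rewrite leq_mul2r mi orbT.
  have lt : (s * m.+1).*2 < n by rewrite dE; lia.
  rewrite SS; last by lia.
  rewrite lt IH ?(ltnW mi) //; move: lt; rewrite !dE mulSn => lt.
  have -> : m * s.*2 + s < n by lia.
  lia.
have ge t : i < t -> n <= (s * t).*2.
  move=> it; have le : i.+1 * s.*2 <= t * s.*2 by rewrite leq_mul2r it orbT.
  by rewrite dE; rewrite mulSn in le; lia.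
have S2 q : (s * (i.+1 + q)).*2 < n.*2 -> S (i.+1 + q) = (S i.+1 - Posz q.*2)%R.
  elim: q => [|q IH] qn; first by rewrite addn0 subr0.
  have lt : (s * (i.+1 + q)).*2 < n.*2.
    by apply: leq_ltn_trans qn; rewrite leq_double leq_mul2l; lia.
  rewrite addnS in qn *; rewrite SS // IH //.
  have le := ge (i.+1 + q) ltac:(lia); rewrite le.
  have -> : ((s * (i.+1 + q)).*2 + s < n) = false by lia.
  lia.
have Si : S i.+1 = (if (j < s)%N then Posz i.*2 - 1 else Posz i.*2 + 1)%R.
  rewrite SS; last by rewrite dE mulSn; lia.
  rewrite S1 // !dE mulSn.
  case: (ltnP j s) => jj.
    have -> : (i * s.*2 + s < n) = false by lia.
    have -> : (n <= i * s.*2) = false by lia.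
    lia.
  have -> : i * s.*2 + s < n by lia.
  have -> : (s.*2 + i * s.*2 < n) = false by lia.
  lia.
case: (ltnP j s) Si => jj Si.
- have i_gt0 : 0 < i by case: (posnP i) nE => // ->; lia.
  have lt : (s * (i.+1 + i.-1)).*2 < n.*2.
    have -> : i.+1 + i.-1 = i + i by lia.
    by rewrite dE mulnDl; lia.
  by exists (i.+1 + i.-1) => //; rewrite -/(S _) S2 // Si; lia.
- have lt : (s * (i.+1 + i)).*2 < n.*2 by rewrite dE addSn mulSn mulnDl; lia.
  by exists (i.+1 + i) => //; rewrite -/(S _) S2 // Si; lia.
Qed.

End Steep.

Lemma wrap_pos_lt n s m : 0 < n -> (s * m).*2 < n.*2 -> wrap_pos n s m < n.
Proof. by rewrite /wrap_pos; case: ifP; lia. Qed.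

Lemma wrap_pos_step n s m : 0 < s -> (s * m.+2).*2 < n.*2 -> wrap_pos n s m.+2 != wrap_pos n s m.
Proof. by rewrite /wrap_pos !mulnS; case: ifP => ?; case: ifP => ?; lia. Qed.

Section SteepGaps.

Variables (n : nat) (M : bool -> 'I_n -> 'I_n) (B : bool -> 'I_n -> nat).
Hypothesis MB : forall c, rainbow (M c) (B c).

Let MK c : involutive (M c) := rainbowK (MB c).

(** Positions two steps apart differ, so the walk never turns back: it moves monotonically along the
    line, and each crossed gap is interior to a block of either colour. *)
Lemma strip_walk_side (h : 'I_n -> int) v s k m :
  (forall i j, i < n -> j < n -> v i = v j -> i = j) ->
  strip M B h v s k -> s.*2 < n -> n - s <= k -> (s * m.+1).*2 < n.*2 ->
  [/\ forall c, B c (v (wrap_pos n s m.+1)) = B c (v n.-1),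
      v (wrap_pos n s 1) < v n.-1 -> v (wrap_pos n s m.+1) < v n.-1 &
      v n.-1 < v (wrap_pos n s 1) -> v n.-1 < v (wrap_pos n s m.+1)].
Proof.
move=> vI vS s2 ks; have [/andP[s_gt0 sn] _ _ _ _] := vS.
have n_gt0 : 0 < n by apply: leq_trans sn.
pose u m := v (wrap_pos n s m); rewrite -!/(u _).
have u0 : u 0 = v n.-1 by rewrite /u /wrap_pos muln0 double0 n_gt0 subn0.
have step t : (s * t.+1).*2 < n.*2 -> gap (u t, u t.+1) /\ forall c, B c (u t) = B c (u t.+1).
  by move=> lt; have [] := strip_walk vS s2 ks lt.
have lt_le t r : r <= t -> (s * t).*2 < n.*2 -> (s * r).*2 < n.*2.
  by move=> rt; apply: leq_ltn_trans; rewrite leq_double leq_mul2l rt orbT.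
have ne t : (s * t.+2).*2 < n.*2 -> u t.+2 != u t.
  move=> lt; apply: contra (wrap_pos_step s_gt0 lt) => /eqP e; apply/eqP.
  by apply: vI e; apply: wrap_pos_lt => //; apply: lt_le lt; rewrite -addn2 leq_addr.
rewrite -u0; elim: m => [|m IH] lt.
  by have [_ e] := step 0 lt; split=> // c; rewrite -e.
have [IB IL IR] := IH (lt_le _ _ (leqnSn _) lt).
have mono t : (s * t.+1).*2 < n.*2 -> (u 1 < u 0 -> u t.+1 < u t) /\ (u 0 < u 1 -> u t < u t.+1).
  elim: t => [//|t IHt] lt'; have [I1 I2] := IHt (lt_le _ _ (leqnSn _) lt').
  have [g1 _] := step t (lt_le _ _ (leqnSn _) lt'); have [g2 _] := step t.+1 lt'.
  have := ne t lt'; rewrite -(inj_eq val_inj); move: g1 g2 I1 I2; rewrite /gap /=.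
  lia.
have [mL mR] := mono _ lt; have [_ e] := step _ lt; split.
- by move=> c; rewrite -e IB.
- by move=> l; apply: ltn_trans (mL l) (IL l).
- by move=> l; apply: ltn_trans (IR l) (mR l).
Qed.

(** A center is an end of the path, and difference 3 means that the strip has passed both ends. This
    leaves two possible places for [c] on the strip; in the real one, [strip_walk] starts from [c]
    towards [a] and reaches difference 1. *)
Lemma strip_center_steep (h : 'I_n -> int) v d s k b c o a :
  alternating_path M v d -> strip M B h v s k -> s <= n - s ->
  (c, o) = (v (right_pos n s k), v (left_pos s k)) \/
    (o, c) = (v (right_pos n s k), v (left_pos s k)) ->
  gap (c, a) -> a != o -> M b c = c ->
  `|h c - h o|%R = 3%R -> `|h c - h a|%R = 2%R ->
  exists z, [/\ B b z = B b c, (a < c -> z < c) /\ (c < a -> c < z),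
    (h c - h o = 3)%R & (h c - h z = 1)%R].
Proof.
move=> vP vS s2 co ga ao Mc d3 d2.
have [/andP[s_gt0 sn] kn gapP innP turnP] := vS.
have [g r] := gapP k (leqnn k).
have sk : n - s <= k.
  case: (leqP (n - s) k) r => // _; case: co => -[<- <-]; rewrite /rise /=; case: (s <= k); lia.
have vE i j : i < n -> j < n -> (v i == v j) = (i == j).
  by move=> im jm; apply/eqP/eqP => [/(alt_inj vP)->|->].
have fixv i : i < n -> M b (v i) = v i -> i = 0 \/ i = n.-1.
  move=> im; case: (eqVneq b (d (+) odd i)) => [->|ne].
    rewrite (alternating_up vP) //; case: ifP => lt e; last by right; lia.
    by have := alt_inj vP lt im e; lia.
  have -> : b = d (+) ~~ odd i by move: ne; case: (b); case: (d); case: (odd i).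
  by rewrite (alternating_down MK vP) // => e; left; have := alt_inj vP _ im e; lia.
have k1 : k.-1 <= k by lia.
have [g1 r1] := gapP _ k1.
have cE : c = v (right_pos n s k) /\ o = v (left_pos s k) /\ k = n - s \/
    c = v (left_pos s k) /\ o = v (right_pos n s k) /\ k = s.
  case: co => -[e1 e2]; [left | right]; split=> //; split=> //.
    have rn : right_pos n s k < n by rewrite /right_pos; case: ifP; lia.
    have := fixv _ rn; rewrite -e1 => /(_ Mc); rewrite /right_pos; case: ifP; lia.
  have ln : left_pos s k < n by rewrite /left_pos; case: ifP; lia.
  have := fixv _ ln; rewrite -e2 => /(_ Mc); rewrite /left_pos; case: ifP; lia.
have go : gap (c, o) by case: co g => -[<- <-] //; rewrite -gap_swap.
have other w : gap (c, w) -> (`|h c - h w| < 3)%R -> w = a.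
  move=> gw lw; apply: (gap_other go gw ga); last by rewrite eq_sym.
  by apply/eqP => ow; rewrite -ow d3 in lw.
(* If [c] is on the left then [n = s.*2], and one step earlier [c] was already there with rise 1;
   that gap must be [(c, a)], against difference 2. *)
case: cE => -[ce [oe ke]]; last first.
  have le : left_pos s k.-1 = left_pos s k by rewrite /left_pos ke; case: ifP => ?; case: ifP => ?; lia.
  have nE : n = s.*2 by lia.
  move: g1 r1; rewrite le -ce -gap_swap /rise /= => g1.
  have -> : (n - s <= k.-1) = false by lia.
  have -> : (s <= k.-1) = false by lia.
  move=> r1; have wa : v (right_pos n s k.-1) = a by apply: other => //; lia.
  by exfalso; move: d2; rewrite -wa; lia.
have re : right_pos n s k.-1 = right_pos n s k by rewrite /right_pos ke; case: ifP => ?; case: ifP => ?; lia.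
have cn : c = v n.-1 by rewrite ce /right_pos ke; congr v; case: ifP; lia.
move: g1 r1; rewrite re -ce /rise /= => g1.
have -> : (n - s <= k.-1) = false by lia.
move=> r1; have wa : v (left_pos s k.-1) = a by apply: other => //; case: (s <= k.-1) r1; lia.
(* The gap one step earlier is [(c, a)]; it has rise 2 only if the other end had been passed by
   then. *)
have s2' : s.*2 < n.
  by move: r1 d2; rewrite wa; case: (leqP s k.-1); lia.
have [m mn hm] := strip_walk_height vS s2' sk.
have w0 : wrap_pos n s 0 = n.-1 by rewrite /wrap_pos muln0; case: ifP; lia.
case: m mn hm => [|m] mn hm; first by rewrite w0 subrr in hm.
have ua : v (wrap_pos n s 1) = a.
  have lt1 : (s * 1).*2 < n.*2 by lia.
  have [gu _ hu] := strip_walk vS s2' sk lt1.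
  rewrite w0 -cn in gu hu; apply: other => //; move: hu.
  by rewrite muln0 muln1 add0n sn s2'; lia.
have [eB lL lR] := strip_walk_side (alt_inj vP) vS s2' sk mn.
exists (v (wrap_pos n s m.+1)); rewrite -ua cn; split=> //.
by move: r; rewrite -ce -oe /rise /= -cn; case: (n - s <= k) sk => //; case: (s <= k); lia.
Qed.

Variables (h : 'I_n -> int) (v0 : nat -> 'I_n) (c0 : bool).
Hypotheses (n_gt0 : 0 < n) (v0P : alternating_path M v0 c0).
Hypothesis hM : forall c (x : 'I_n), x < M c x -> h (M c x) = (h x + (if c then -1 else 1))%R.

Lemma gap_rise x y : gap (x, y) -> (1 <= `|h x - h y| <= 3)%R.
Proof.
move=> g; have [v [c [s [k [vP [_ _ gapP _ _] e]]]]] := strip_cover n_gt0 MB hM v0P g.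
have [_ r] := gapP k (leqnn k).
by case: e r => -[<- <-]; rewrite /rise /=; case: (_ <= k); case: (_ <= k); lia.
Qed.

(** [strip_steep] needs [s <= n - s]; otherwise [strip_rev] reverses the path and negates heights,
    whence the two alternatives of sign. *)
Lemma steep_gap x x' : gap (x, x') -> `|h x - h x'|%R = 3%R -> exists y o z,
  [/\ (x, x') = (y, o) \/ (x', x) = (y, o), gap (y, z), z != o,
      (h y - h o = 3 /\ 1 <= h y - h z <= 2)%R \/ (h o - h y = 3 /\ 1 <= h z - h y <= 2)%R &
      forall c, [/\ B c y = B c z, M c y != z &
                    M c y != y -> (`|h (M c y) - h (M c z)| <= 2)%R]].
Proof.
move=> g d3; have [v [c [s [k [vP vS e]]]]] := strip_cover n_gt0 MB hM v0P g.
have [sn kn gapP _ _] := vS; have [gk r] := gapP k (leqnn k).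
have [nk sk] : n - s <= k /\ s <= k.
  by case: e r => -[<- <-]; rewrite /rise /=; case: (leqP (n - s) k); case: (leqP s k); lia.
case: (leqP s (n - s)) => s2.
  have [z [gz hz zP]] := strip_steep vS s2 nk.
  exists (v (right_pos n s k)), (v (left_pos s k)), z.
  have h3 : (h (v (right_pos n s k)) - h (v (left_pos s k)) = 3)%R.
    by move: r; rewrite /rise /= nk sk.
  split=> //; last by left.
  by apply/eqP => zo; move: hz; rewrite zo h3.
have [||z] := strip_steep (strip_rev MK vS); try lia.
have -> : n.-1 - right_pos n (n - s) k = left_pos s k.
  by rewrite /right_pos /left_pos; case: ifP => ?; case: ifP => ?; lia.
move=> [gz hz zP]; exists (v (left_pos s k)), (v (right_pos n s k)), z.
have h3 : (h (v (right_pos n s k)) - h (v (left_pos s k)) = 3)%R.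
  by move: r; rewrite /rise /= nk sk.
split=> //.
- by case: e => -[<- <-]; [right | left].
- by apply/eqP => zo; move: hz; rewrite zo; lia.
- by right; split=> //; lia.
- by move=> c'; have [b1 b2 b3] := zP c'; split=> // /b3; lia.
Qed.

Lemma center_steep b c o a : gap (c, o) -> gap (c, a) -> a != o -> M b c = c ->
  `|h c - h o|%R = 3%R -> `|h c - h a|%R = 2%R ->
  exists z, [/\ B b z = B b c, (a < c -> z < c) /\ (c < a -> c < z) &
    (h c - h o = 3)%R /\ (h c - h z = 1)%R \/ (h o - h c = 3)%R /\ (h z - h c = 1)%R].
Proof.
move=> go ga ao Mc d3 d2.
have [v [d [s [k [vP vS e]]]]] := strip_cover n_gt0 MB hM v0P go.
have [sn kn _ _ _] := vS.
case: (leqP s (n - s)) => s2.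
  have [|z [Bz side h1 h2]] := strip_center_steep vP vS s2 _ ga ao Mc d3 d2.
    by case: e => e; [left | right].
  by exists z; split=> //; left.
have lE : left_pos (n - s) k = n.-1 - right_pos n s k.
  by rewrite /right_pos /left_pos; case: ifP => ?; case: ifP => ?; lia.
have rE : right_pos n (n - s) k = n.-1 - left_pos s k.
  by rewrite /right_pos /left_pos; case: ifP => ?; case: ifP => ?; lia.
have rn : right_pos n s k < n by rewrite /right_pos; case: ifP; lia.
have ln : left_pos s k < n by rewrite /left_pos; case: ifP; lia.
have [||||z [Bz side h1 h2]] := strip_center_steep (o := o) (alternating_rev MK vP n_gt0)
  (strip_rev MK vS) _ _ ga ao Mc; rewrite ?lE ?rE ?subKn; try lia.
  by case: e => -[<- <-]; [right | left].
by exists z; split=> //; right; lia.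
Qed.

End SteepGaps.

(** * Eigenvalues of one block *)

Section Unbroken.

Variables (n : nat) (M : 'I_n -> 'I_n) (B : 'I_n -> nat) (k : 'I_n -> int).
Hypothesis MB : rainbow M B.
Hypothesis kM : forall x : 'I_n, x < M x -> k (M x) = (k x - 1)%R.
Hypothesis k_gap : forall x y, gap (x, y) -> (1 <= `|k x - k y| <= 3)%R.
Hypothesis k_steep : forall x x', gap (x, x') -> `|k x - k x'|%R = 3%R -> exists y o z,
  [/\ (x, x') = (y, o) \/ (x', x) = (y, o), gap (y, z), z != o,
      (k y - k o = 3 /\ 1 <= k y - k z <= 2)%R \/ (k o - k y = 3 /\ 1 <= k z - k y <= 2)%R &
      [/\ B y = B z, M y != z & M y != y -> (`|k (M y) - k (M z)| <= 2)%R]].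
Hypothesis k_center : forall c o a, gap (c, o) -> gap (c, a) -> a != o -> M c = c ->
  `|k c - k o|%R = 3%R -> `|k c - k a|%R = 2%R ->
  exists z, [/\ B z = B c, (a < c -> z < c) /\ (c < a -> c < z) &
    (k c - k o = 3)%R /\ (k c - k z = 1)%R \/ (k o - k c = 3)%R /\ (k z - k c = 1)%R].

Let MK : involutive M := rainbowK MB.
Let sumE (x y : 'I_n) : B x = B y -> M x + x = M y + y := rainbow_sum MB (x := x) (y := y).

Let between (x y z : 'I_n) : x <= y <= z -> B x = B z -> B y = B x.
Proof.
move=> /andP[xy yz] e; have := rainbow_mono MB xy; have := rainbow_mono MB yz; lia.
Qed.

(** [m] bounds the distance between [x] and [y]; [x] moves towards [y] until its next vertex leaps
    over both [v] and [v + 1]. *)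
Let cross m (v : int) (x y : 'I_n) : x <= y + m -> y <= x + m -> x < M x -> y < M y -> B x = B y ->
  (k x < v)%R -> (v + 1 < k y)%R ->
  (forall z : 'I_n, B z = B x -> z < M z -> k z <> v /\ k z <> (v + 1)%R) ->
  exists i j : 'I_n, [/\ gap (i, j), i < M i, j < M j, B i = B x /\ B j = B x & (k i < v)%R /\ (v + 1 < k j)%R].
Proof.
elim: m x y => [|m IH] x y.
  rewrite !addn0 => xy yx _ _ _ kx ky; have e : x = y by apply/val_inj/eqP; rewrite eqn_leq xy yx.
  by rewrite e in kx; lia.
move=> xy yx xL yL e kx ky nz.
case: (ltngtP x y) => lt; last by rewrite (val_inj lt) in kx; lia.
- have x'n : x.+1 < n by have := ltn_ord y; lia.
  pose x' := Ordinal x'n.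
  have x'B : B x' = B x by apply: (between _ e); rewrite /= leqnSn.
  have x'L : x' < M x' by have := sumE x'B; have := sumE e; rewrite /=; lia.
  have [n1 n2] := nz x' x'B x'L.
  case: (ltrP (k x') v) => kx'.
    have le1 : x' <= y + m by rewrite /=; lia.
    have le2 : y <= x' + m by rewrite /=; lia.
    by have := IH x' y le1 le2 x'L yL; rewrite x'B; apply.
  by exists x, x'; split=> //; rewrite /gap ?eqxx //; split=> //; lia.
- have x'n : x.-1 < n by have := ltn_ord x; lia.
  pose x' := Ordinal x'n.
  have x'B : B x' = B x.
    by rewrite e; apply: (between _ (esym e)); rewrite /=; lia.
  have x'L : x' < M x' by have := sumE x'B; rewrite /=; lia.
  have [n1 n2] := nz x' x'B x'L.
  case: (ltrP (k x') v) => kx'.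
    have le1 : x' <= y + m by rewrite /=; lia.
    have le2 : y <= x' + m by rewrite /=; lia.
    by have := IH x' y le1 le2 x'L yL; rewrite x'B; apply.
  by exists x, x'; split=> //; [rewrite /gap /=; lia | split=> //; lia].
Qed.

Let gap_mirror (x y : 'I_n) : B x = B y -> gap (x, y) -> gap (M x, M y).
Proof. by move=> /sumE; rewrite /gap /=; lia. Qed.

(** A leap over [v] and [v + 1] is a gap of difference 3. The vertex [z] from [k_steep] has one of
    these values, and it is not in the right half, for it would then be the mirror of its
    neighbour. *)
Lemma half_no_jump (v : int) (x y : 'I_n) : x < M x -> y < M y -> B x = B y ->
  (k x < v)%R -> (v + 1 < k y)%R ->
  exists2 z, B z = B x & z < M z /\ (k z = v \/ k z = v + 1)%R \/ M z = z /\ k z = v.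
Proof.
move=> xL yL e kx ky.
case: (boolP [exists z, (B z == B x) && ((z < M z) && ((k z == v) || (k z == v + 1)%R))]).
  by case/existsP => z /andP[/eqP zB /andP[zL /orP[]/eqP kz]]; exists z => //; left; split=> //; [left|right].
move=> /existsPn nz.
have [||z zB zL|i [j [ij iL jL [iB jB] [ki kj]]]] := cross (m := n) _ _ xL yL e kx ky.
- by have := ltn_ord x; lia.
- by have := ltn_ord y; lia.
- by have := nz z; rewrite zB eqxx zL /= negb_or => /andP[/eqP ? /eqP].
have Lno z : B z = B x -> z < M z -> k z <> v /\ k z <> (v + 1)%R.
  by move=> zB zL; have := nz z; rewrite zB eqxx zL /= negb_or => /andP[/eqP ? /eqP].
have k3 : (k j - k i = 3)%R by have := k_gap ij; lia.
have [y0 [o [z [yo gz zo hz [yzB My Mz]]]]] := k_steep ij (ltac:(lia)).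
have right_absurd : y0 < M y0 -> z <> o -> M z < z -> False.
  move=> y0L _ zR; have := sumE yzB; move: gz My; rewrite /gap -(inj_eq val_inj) /=; lia.
have y0L : y0 < M y0 by case: yo => -[<- _].
have y0B : B y0 = B x by case: yo => -[<- _].
have zB : B z = B x by rewrite -yzB.
exists z => //; right.
have kz : (k z = v \/ k z = v + 1)%R.
  by case: yo hz => -[<- <-]; lia.
case: (ltngtP z (M z)) => zM.
- by have [] := Lno z zB zM; case: kz.
- by case: (right_absurd y0L _ zM) => zo'; rewrite zo' eqxx in zo.
have zM' : M z = z by apply: val_inj.
(* A center of value [v + 1] would differ from [M y0] by 3 or by 0, against [k_steep] and [k_gap]
   respectively. *)
split=> //; case: kz => // kz; exfalso.
have kMy := kM y0L.
have ne : M y0 != y0 by rewrite -(inj_eq val_inj) /=; lia.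
have := Mz ne; have := k_gap (gap_mirror yzB gz); rewrite zM' kMy.
by case: yo hz => -[<- <-]; lia.
Qed.

(** The left neighbour of the center serves unless the center is 2 above it and 3 above its mirror;
    that is the situation of [k_center]. The proof of [center_below] is the dual, with a final
    reflection into the left half. *)
Lemma center_above c x : M c = c -> B x = B c -> x < M x -> exists2 z, B z = B c & z < M z /\ (k c - 1 <= k z)%R.
Proof.
move=> Mc xB xL; have xc := sumE xB; rewrite Mc in xc.
have an : c.-1 < n by have := ltn_ord c; lia.
pose a := Ordinal an.
have aB : B a = B c by rewrite -xB; apply: between xB; rewrite /=; lia.
have ac := sumE aB; rewrite Mc /= in ac.
have aL : a < M a by rewrite /=; lia.
have ga : gap (c, a) by rewrite /gap /=; lia.
have go : gap (c, M a) by rewrite /gap /=; lia.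
case: (lerP (k c - 1)%R (k a)) => ka; first by exists a.
have kMa := kM aL; have := k_gap go => kgo.
have ne : a != M a by rewrite -(inj_eq val_inj) /=; lia.
have [||z [zB [zl _] zk]] := k_center go ga ne Mc; try lia.
have zc := sumE zB; rewrite Mc in zc.
have lt : z < c by apply: zl; rewrite /=; lia.
by exists z => //; split; lia.
Qed.

Lemma center_below c x : M c = c -> B x = B c -> x < M x -> exists2 z, B z = B c & z < M z /\ (k z <= k c + 2)%R.
Proof.
move=> Mc xB xL; have xc := sumE xB; rewrite Mc in xc.
have an : c.-1 < n by have := ltn_ord c; lia.
pose a := Ordinal an.
have aB : B a = B c by rewrite -xB; apply: between xB; rewrite /=; lia.
have ac := sumE aB; rewrite Mc /= in ac.
have aL : a < M a by rewrite /=; lia.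
have ga : gap (c, a) by rewrite /gap /=; lia.
have go : gap (c, M a) by rewrite /gap /=; lia.
case: (lerP (k a) (k c + 2)%R) => ka; first by exists a.
have kMa := kM aL; have := k_gap ga => kgo.
have ne : M a != a by rewrite -(inj_eq val_inj) /=; lia.
have [||z [zB [_ zl] zk]] := k_center ga go ne Mc; try lia.
have zc := sumE zB; rewrite Mc in zc.
have lt : c < z by apply: zl; lia.
have zL : M z < M (M z) by rewrite MK; lia.
have := kM zL; rewrite MK => kz.
by exists (M z); [rewrite (rainbow_block MB) | split=> //; lia].
Qed.

Definition attained (e : int) : Prop := exists x y : 'I_n, [/\ B x = B y, y <= x & (k y - k x)%R = e].

(** Mirroring [w] adds 1 to the difference; mirroring both vertices keeps it and reverses their
    order. *)
Let half_diff (u w : 'I_n) : u < M u -> w < M w -> B u = B w ->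
  attained (k u - k w)%R /\ attained (k u - k w + 1)%R.
Proof.
move=> uL wL e; have se := sumE e; have kw := kM wL; have ku := kM uL; split; last first.
  by exists (M w), u; rewrite (rainbow_block MB); split=> //; lia.
case: (leqP u w) => uw; first by exists w, u.
by exists (M w), (M u); rewrite !(rainbow_block MB); split=> //; lia.
Qed.

Let attained1 (x : 'I_n) : x < M x -> attained 1%R.
Proof. by move=> xL; have [_] := half_diff xL xL erefl; rewrite subrr add0r. Qed.

Let half_step (u w : 'I_n) e : u < M u -> w < M w -> B u = B w -> (k u - k w)%R = e -> (2 <= e)%R ->
  attained (e - 1)%R.
Proof.
move=> uL wL uw ke e2; case: (eqVneq e 2%R) => [->|ne2]; first exact: attained1 uL.
have [||z zB] := half_no_jump (v := (k w + e - 2)%R) wL uL (esym uw); try lia.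
case=> [[zL kz]|[Mz kz]].
  have [a0 a1] := half_diff zL wL zB.
  by case: kz => kz; [have -> : (e - 1 = k z - k w + 1)%R by lia | have -> : (e - 1 = k z - k w)%R by lia].
have kw := kM wL; have := sumE zB; rewrite Mz => sz.
by exists (M w), z; rewrite (rainbow_block MB); split=> //; lia.
Qed.

(** Reflection reduces to differences within the left half, where [half_no_jump] supplies [e - 2] or
    [e - 1], and [half_diff] turns either into [e - 1]. If a member is a center, a left vertex from
    [center_above] or [center_below] replaces it. *)
Lemma attained_pred e : (2 <= e)%R -> attained e -> attained (e - 1)%R.
Proof.
move=> e2 [x [y [xyB yx ke]]]; have se := sumE xyB.
have xy : x != y by apply: contraTneq e2 => xy; rewrite -ke xy subrr.
have lt : y < x by rewrite ltn_neqAle yx andbT eq_sym.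
case: (ltngtP x (M x)) => xM.
- have yL : y < M y by lia.
  exact: (half_step yL xM (esym xyB) ke e2).
- have xL : M x < M (M x) by rewrite MK.
  have := kM xL; rewrite MK => kx.
  case: (ltngtP y (M y)) => yM.
  + have -> : (e - 1 = k y - k (M x))%R by lia.
    by have [] := half_diff yM xL; rewrite ?(rainbow_block MB).
  + have yL : M y < M (M y) by rewrite MK.
    have := kM yL; rewrite MK => ky.
    by apply: (half_step yL xL); rewrite ?(rainbow_block MB) //; lia.
  + have My : M y = y by apply: val_inj.
    have MxB : B (M x) = B y by rewrite (rainbow_block MB).
    have [z zB [zL kz]] := center_above My MxB xL.
    have zxB : B z = B (M x) by rewrite zB.
    have [a0 a1] := half_diff zL xL zxB.
    case: (eqVneq e 2%R) => [->|ne2]; first exact: attained1 xL.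
    have [d|[d|d]] : (k z - k (M x) = e - 2)%R \/ (k z - k (M x) = e - 1)%R \/ (e <= k z - k (M x))%R by lia.
    * by move: a1; rewrite d; have -> : (e - 2 + 1 = e - 1)%R by lia.
    * by rewrite -d.
    have [||w wB] := half_no_jump (v := (k (M x) + e - 2)%R) xL zL (esym zxB); try lia.
    case=> [[wL kw]|[Mw kw]].
      have [b0 b1] := half_diff wL xL wB.
      by case: kw => kw; [have -> : (e - 1 = k w - k (M x) + 1)%R by lia
                         | have -> : (e - 1 = k w - k (M x))%R by lia].
    (* A block has one center, and the value of [y] is one more than the one sought. *)
    exfalso; have wy : w = y.
      by have := sumE (etrans wB MxB); rewrite Mw My => ww; apply/ord_inj; lia.
    by move: kw; rewrite wy; lia.
- have Mx : M x = x by apply: val_inj.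
  have yL : y < M y by move: se; rewrite Mx; lia.
  have [z zB [zL kz]] := center_below Mx (esym xyB) yL.
  have yzB : B y = B z by rewrite zB.
  have [a0 a1] := half_diff yL zL yzB.
  case: (eqVneq e 2%R) => [->|ne2]; first exact: attained1 yL.
  have [d|[d|d]] : (k y - k z = e - 2)%R \/ (k y - k z = e - 1)%R \/ (e <= k y - k z)%R by lia.
  + by move: a1; rewrite d; have -> : (e - 2 + 1 = e - 1)%R by lia.
  + by rewrite -d.
  have [||w wB] := half_no_jump (v := (k y - e + 1)%R) zL yL (esym yzB); try lia.
  case=> [[wL kw]|[Mw kw]].
    have ywB : B y = B w by rewrite wB.
    have [b0 b1] := half_diff yL wL ywB.
    by case: kw => kw; [have -> : (e - 1 = k y - k w)%R by lia
                       | have -> : (e - 1 = k y - k w + 1)%R by lia].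
  exfalso; have wx : w = x.
    by have := sumE (etrans wB zB); rewrite Mw Mx => ww; apply/ord_inj; lia.
  by move: kw; rewrite wx; lia.
Qed.

End Unbroken.

(** * The spectrum *)

Local Open Scope ring_scope.

Lemma count_mem_image (T : finType) (P : pred T) (f : T -> int) e :
  count_mem e [seq f x | x in P] = #|[set x in P | f x == e]|.
Proof.
rewrite count_map -size_filter cardE; congr size.
rewrite /enum_mem -filter_predI; apply: eq_filter => x.
by rewrite !inE /= andbC.
Qed.

Section Spectrum.

Variables (n : nat) (a b : seq nat).
Hypotheses (n_gt0 : (0 < n)%N) (a_comp : composition n a) (b_comp : composition n b).
Hypothesis M_frob : frobenius n a b.

Let measures : seq int := [seq measure a b x.1 x.2 | x : 'I_n * 'I_n in admissible a b].

Lemma measures0 : 0 \in measures.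
Proof.
have [h [_ mE]] := frobenius_height n_gt0 a_comp b_comp M_frob.
have [x] : exists x : 'I_n, x == x by exists (Ordinal n_gt0).
move=> _; apply/imageP; exists (x, x); last by rewrite mE subrr.
by rewrite unfold_in /admissible /= leqnn !same_block_id // !eqxx ?andbT ?orbT.
Qed.

Lemma dimensionE e : ((e == 0%R) + dimension n a b e = count_mem e measures)%N.
Proof.
have /permP -> := perm_to_rem measures0.
by rewrite /= eq_sym.
Qed.

Variable h : 'I_n -> int.
Hypothesis hM : forall c (x : 'I_n), (x < mate a b c x)%N ->
  h (mate a b c x) = h x + (if c then -1 else 1).
Hypothesis mE : forall u w, measure a b u w = h w - h u.

Let sgn (c : bool) (x : 'I_n) : int := if c then h x else - h x.
Let pairs c e := block_pairs (block a b c) (sgn c) e.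

Let sgnM c (x : 'I_n) : (x < mate a b c x)%N -> sgn c (mate a b c x) = sgn c x - 1.
Proof. by move=> lt; have := hM lt; rewrite /sgn; case: c {lt} => ->; lia. Qed.

(** A pair [(x, x)] is admissible once, through the top clause, but belongs to the pairs of both
    colours; this is the term with [n]. *)
Lemma count_measures e :
  (count_mem e measures + n * (e == 0%R) = #|pairs true e| + #|pairs false e|)%N.
Proof.
pose low : {set 'I_n * 'I_n} := [set p in pairs false e | (p.2 < p.1)%N].
pose diag : {set 'I_n * 'I_n} := [set p in pairs false e | p.1 == p.2].
pose flip (p : 'I_n * 'I_n) := (p.2, p.1).
have flipI : injective flip by move=> [x y] [x' y'] [-> ->].
rewrite count_mem_image.
have -> : [set x in admissible a b | measure a b x.1 x.2 == e] = pairs true e :|: flip @: low.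
  apply/setP => -[x y]; have adm : ((x, y) \in admissible a b) = admissible a b (x, y) by [].
  rewrite !inE mE adm /admissible /= !same_block_id //.
  have -> : ((x, y) \in flip @: low) = (x < y)%N && (block a b false x == block a b false y) && (h y - h x == e).
    apply/imsetP/idP => [[[x' y']]|].
      rewrite !inE /sgn /= => /andP[/and3P[bE _ /eqP <-] lt] [-> ->].
      by rewrite lt eq_sym bE /=; apply/eqP; lia.
    move=> /andP[/andP[lt bE] /eqP eE]; exists (y, x) => //.
    by rewrite !inE /sgn /= eq_sym bE lt ltnW //= andbT; apply/eqP; lia.
  rewrite /sgn /block /=; case: (h y - h x == e); rewrite ?andbF ?andbT //=.
  by rewrite orbC [(y <= x)%N && _]andbC.
have diagE : #|diag| = (n * (e == 0%R))%N.
  have inj : injective (fun x : 'I_n => (x, x)) by move=> x y [].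
  case: (eqVneq e 0%R) => [ez|e0].
    rewrite muln1 -[RHS](card_ord n) -(card_imset _ inj); apply: eq_card => -[x y].
    apply/idP/imsetP => [|[z _ [-> ->]]]; first by rewrite !inE /= => /andP[_ /eqP <-]; exists x.
    by rewrite !inE /= ez !eqxx leqnn subrr eqxx.
  rewrite muln0; apply/eqP; rewrite cards_eq0; apply/eqP/setP => -[x y].
  rewrite !inE /=; case: (eqVneq x y) => [<-|]; rewrite ?andbF //.
  by rewrite subrr eq_sym (negPf e0) !andbF.
have -> : pairs false e = low :|: diag.
  apply/setP => -[x y]; rewrite /low /diag !inE /=.
  case: (boolP (_ && _)) => //= /and3P[_ yx _].
  by move: yx; rewrite leq_eqVlt -(inj_eq val_inj) orbC eq_sym => ->.
rewrite -diagE !cardsU.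
have -> : pairs true e :&: flip @: low = set0.
  apply/setP => -[x y]; rewrite !inE /=; apply/negP => /andP[/and3P[_ yx _]].
  by case/imsetP => -[x' y']; rewrite !inE /= => /andP[_ lt] [ex ey]; move: yx lt; rewrite ex ey; lia.
have -> : low :&: diag = set0.
  apply/setP => -[x y]; rewrite !inE /=; apply/negP => /andP[/andP[_ lt] /andP[_ /eqP e']].
  by rewrite e' ltnn in lt.
by rewrite !cards0 !subn0 addnA card_imset.
Qed.

(** Each colour has twice its left halves plus its centers equal to [n], and there are two centers
    in all. So the left halves total [n - 1], the number of edges. *)
Lemma card_left_halves :
  (#|left_half (@mate n a b true)| + #|centers (@mate n a b true)| +
   (#|left_half (@mate n a b false)| + #|centers (@mate n a b false)|) = n.+1)%N /\
  ((1 < n)%N -> exists (c : bool) (x : 'I_n), (x < mate a b c x)%N).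
Proof.
have [v [c [vP _]]] := frobenius_alternating n_gt0 a_comp b_comp M_frob.
have MK d := mateK a_comp b_comp d.
have := card_halves (mate_rainbow a_comp b_comp true).
have := card_halves (mate_rainbow a_comp b_comp false).
have fix2 : (#|centers (@mate n a b true)| + #|centers (@mate n a b false)| = 2)%N.
  rewrite !(card_fixed MK vP) //; by case: (c); case: (odd _).
move=> e1 e2; split; first lia.
move=> n1; have [|] : (0 < #|left_half (@mate n a b true)| \/ 0 < #|left_half (@mate n a b false)|)%N by lia.
- by case/card_gt0P => x; rewrite inE => lt; exists true, x.
- by case/card_gt0P => x; rewrite inE => lt; exists false, x.
Qed.

Lemma dimension_symmetric e : dimension n a b e = dimension n a b (1 - e).
Proof.
have [halves _] := card_left_halves.
have := dimensionE e; have := dimensionE (1 - e).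
have := count_measures e; have := count_measures (1 - e).
pose H c := (#|left_half (@mate n a b c)| + #|centers (@mate n a b c)|)%N.
pose Q c f := #|pairs c f|.
have P c : (Q c e + H c * (e == 1%R) = Q c (1 - e)%R + H c * (e == 0%R))%N.
  exact: card_block_pairs (mate_rainbow a_comp b_comp c) (@sgnM c) e.
have := P true; have := P false.
rewrite -!/(Q _ _) -/(H true) -/(H false) in halves *.
have -> : (1 - e == 0) = (e == 1) by lia.
have : ~~ ((e == 0) && (e == 1)) by lia.
clearbody H Q; move: (count_mem _ _) (count_mem _ _) (dimension _ _ _ _) (dimension _ _ _ _).
move: (Q true e) (Q false e) (Q true (1 - e)) (Q false (1 - e)) => {P}.
by case: (e == 0); case: (e == 1) => //=; rewrite ?muln0 ?muln1; lia.
Qed.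

Lemma dimension_pairs e : e != 0 ->
  (0 < dimension n a b e)%N <-> exists c, attained (block a b c) (sgn c) e.
Proof.
move=> e0; have := dimensionE e; have := count_measures e.
rewrite (negPf e0) muln0 addn0 add0n => -> ->.
have pairsP c : (0 < #|pairs c e|)%N <-> attained (block a b c) (sgn c) e.
  split=> [/card_gt0P[[x y]]|[x [y [bE yx ke]]]].
    by rewrite inE /= => /and3P[/eqP bE yx /eqP ke]; exists x, y.
  by apply/card_gt0P; exists (x, y); rewrite inE /= bE yx ke !eqxx.
rewrite addn_gt0; split=> [/orP[]/pairsP H|[[] /pairsP H]]; [by exists true | by exists false | by rewrite H | by rewrite H orbT].
Qed.

Lemma dimension_pred e : 2 <= e -> (0 < dimension n a b e)%N -> (0 < dimension n a b (e - 1))%N.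
Proof.
move=> e2 H; have e0 : e != 0 by lia.
have [c ac] := (dimension_pairs e0).1 H.
have e1 : e - 1 != 0 by lia.
apply/(dimension_pairs e1); exists c.
have [v [d [vP _]]] := frobenius_alternating n_gt0 a_comp b_comp M_frob.
have MB d' := mate_rainbow a_comp b_comp d'.
apply: (attained_pred (MB c) (@sgnM c) _ _ _ e2 ac).
- move=> x y g; have := gap_rise MB n_gt0 vP hM g.
  by rewrite /sgn; case: (c); lia.
- move=> x x' g d3.
  have d3' : `|h x - h x'| = 3 by move: d3; rewrite /sgn; case: (c); lia.
  have [y [o [z [yo gz zo hz zP]]]] := steep_gap MB n_gt0 vP hM g d3'.
  exists y, o, z; have [B1 M1 M2] := zP c; split=> //.
    by move: hz; rewrite /sgn; case: (c) => //; lia.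
  by split=> // ne; have := M2 ne; rewrite /sgn; case: (c) => //; lia.
- move=> x o y go ga ne Mx d3 d2.
  have d3' : `|h x - h o| = 3 by move: d3; rewrite /sgn; case: (c); lia.
  have d2' : `|h x - h y| = 2 by move: d2; rewrite /sgn; case: (c); lia.
  have [z [Bz zl hz]] := center_steep MB n_gt0 vP hM go ga ne Mx d3' d2'.
  exists z; split=> //; move: hz; rewrite /sgn; case: (c) => //; lia.
Qed.

Lemma dimension1 : (1 < n)%N -> (0 < dimension n a b 1)%N.
Proof.
move=> n1; have [_ /(_ n1)[c [x lt]]] := card_left_halves.
apply/dimension_pairs => //; exists c, (mate a b c x), x.
split; [exact: (rainbow_block (mate_rainbow a_comp b_comp c)) | exact: ltnW |].
by rewrite sgnM //; lia.
Qed.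

Lemma eigenvalueE e : is_eigenvalue n a b e = (0 < dimension n a b e)%N.
Proof. by rewrite /is_eigenvalue /dimension -has_count has_pred1. Qed.

(** [m + 1] is the largest eigenvalue. Descent by [dimension_pred] reaches 1, and symmetry covers
    [e <= 0]. *)
Lemma unbroken : (1 < n)%N -> exists m : nat, forall e : int,
  is_eigenvalue n a b e = (- m%:Z <= e <= m%:Z + 1).
Proof.
move=> n1; pose P i := (0 < dimension n a b (i%:Z + 1))%N.
have exP : exists i, P i by exists 0%N; rewrite /P add0r dimension1.
have ubP i : P i -> (i <= \max_(x <- spectrum n a b) `|x|)%N.
  rewrite /P -eigenvalueE => ie.
  have H := @leq_bigmax_seq _ (spectrum n a b) xpredT (fun x : int => `|x|%N) _ ie isT.
  by apply: leq_trans H; lia.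
case: (ex_maxnP exP ubP) => m Pm mP; exists m => e.
have Pi i : P i = (i <= m)%N.
  apply/idP/idP => [/mP //|im]; rewrite -(subKn im); elim: (m - i)%N => [|j IH].
    by rewrite subn0.
  case: (ltnP j m) => jm; last first.
    by have -> : (m - j.+1 = m - j)%N by lia.
  have := IH; rewrite /P => /(@dimension_pred _ _) H.
  have -> : (m - j.+1)%N%:Z + 1 = ((m - j)%N%:Z + 1) - 1 by lia.
  by apply: H; lia.
rewrite eigenvalueE; case: (lerP 1 e) => e1.
  have -> : e = (`|e|.-1)%N%:Z + 1 by lia.
  by rewrite -/(P _) Pi; lia.
rewrite dimension_symmetric; have -> : 1 - e = `|e|%N%:Z + 1 by lia.
by rewrite -/(P _) Pi; lia.
Qed.

End Spectrum.

Theorem theorem9 (n : nat) (a b : seq nat) (n_gt0 : (0 < n)%N)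
    (a_comp : composition n a) (b_comp : composition n b)
    (M_frob : frobenius n a b) :
  (n = 1%N /\ spectrum n a b = [::]) \/
  (exists m : nat,
     (forall e : int,
        is_eigenvalue n a b e = (- m%:Z <= e <= m%:Z + 1)) /\
     (forall e : int, - m%:Z <= e <= m%:Z + 1 ->
        dimension n a b e = dimension n a b (1 - e))).
Proof.
have [h [hM mE]] := frobenius_height n_gt0 a_comp b_comp M_frob.
case: (ltnP 1 n) => n1.
  right; have [m mP] := unbroken n_gt0 a_comp b_comp M_frob hM mE n1.
  by exists m; split=> // e _; apply: dimension_symmetric hM mE _.
have nE : n = 1%N by lia.
(* For [n = 1] at most one pair is admissible, and its measure 0 is removed. *)
left; split=> //; apply/nilP; rewrite /nilp /spectrum size_rem; last exact: measures0.
rewrite size_map -cardE -subn1 subn_eq0.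
apply: leq_trans (max_card _) _.
by rewrite card_prod card_ord nE.
Qed.
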